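(* Let $K$ be a field of characteristic $p\ge 0$ and $n\ge1$. The Loewy length of the $K$-algebra $K\,\mathrm{Irr}\,W_n$ is equal to $$\begin{cases}1 & \text{if }p=0,\\ n+1 & \text{if }p=2,\\ [n/p]+1 & \text{if }p>2,\end{cases}$$ where $[n/p]$ denotes the integer part of $n/p$.
   Context: $W_n$ is the group of permutations $\sigma$ of $\{\pm1,\dots,\pm n\}$ with $\sigma(-i)=-\sigma(i)$ for all $i$ (the Weyl group of type $B_n$). $\mathbb{Z}\,\mathrm{Irr}\,W_n$ is the ring of virtual complex characters of $W_n$ (multiplication given by tensor product), and $K\,\mathrm{Irr}\,W_n=K\otimes_{\mathbb{Z}}\mathbb{Z}\,\mathrm{Irr}\,W_n$. The Loewy length of a finite-dimensional $K$-algebra $A$ with Jacobson radical $\mathrm{Rad}\,A$ is the least $r\ge1$ with $(\mathrm{Rad}\,A)^r=0$. *)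

(* Defs.v *)
From HB Require Import structures.
From mathcomp Require Import all_boot all_order all_algebra all_fingroup.
From mathcomp Require Import all_solvable all_field all_character.
From mathcomp Require Import boolp classical_sets.

Set Implicit Arguments.
Unset Strict Implicit.
Unset Printing Implicit Defensive.

Import Order.TTheory GRing.Theory Num.Theory.
Local Open Scope group_scope.
Local Open Scope ring_scope.

(* The set {+-1, ..., +-n}: (i, false) stands for the integer i + 1 and       *)
(* (i, true) for the integer -(i + 1), where i ranges over 0, ..., n - 1.    *)
Definition signed (n : nat) : finType := ('I_n * bool)%type.

Definition sopp (n : nat) (x : signed n) : signed n := (x.1, ~~ x.2).

Definition W_set (n : nat) : {set {perm signed n}} :=
  [set s : {perm signed n} | [forall x, s (sopp x) == sopp (s x)]].

Lemma W_group_set n : group_set (W_set n).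
Proof.
apply/group_setP; split=> [|s t].
  by rewrite inE; apply/forallP => x; rewrite !perm1.
rewrite !inE => /forallP Hs /forallP Ht; apply/forallP => x.
by rewrite !permM (eqP (Hs x)) (eqP (Ht (s x))).
Qed.

Definition W (n : nat) : {group {perm signed n}} := Group (W_group_set n).

(* Characters take their values in the field algC of algebraic numbers; for  *)
(* a finite group these are exactly the complex characters.                  *)
Record ZIrr (gT : finGroupType) (G : {group gT}) := MkZIrr {
  zirr_val :> 'CF(G);
  _ : zirr_val \in 'Z[irr G]
}.

Section ZIrrRing.
Variables (gT : finGroupType) (G : {group gT}).
HB.instance Definition _ := [isSub for @zirr_val gT G].
HB.instance Definition _ := [Choice of ZIrr G by <:].
HB.instance Definition _ := [SubChoice_isSubComNzRing of ZIrr G by <:].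
End ZIrrRing.

(* Z Irr G is free with basis irr G, so its extension of scalars is the       *)
(* K-vector space of coordinate vectors indexed by irr G, multiplied with     *)
(* the integral structure constants of Z Irr G.  The universal property       *)
(* of K (x)_Z Z Irr G is lemma KIrr_universal below.                          *)
Definition KIrr (K : fieldType) (gT : finGroupType) (G : {group gT}) : Type :=
  'rV[K]_(Nirr G).

Section KIrrAlgebra.
Variables (K : fieldType) (gT : finGroupType) (G : {group gT}).

HB.instance Definition _ := Vector.copy (KIrr K G) 'rV[K]_(Nirr G).

(* The inner products are integers here, so Num.floor only changes the type. *)
Definition KIrr_of_vchar (phi : 'CF(G)) : KIrr K G :=
  \row_k (Num.floor '[phi, 'chi_k])%:~R.

Definition KIrr_one : KIrr K G := KIrr_of_vchar 1.

Definition KIrr_mul (u v : KIrr K G) : KIrr K G :=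
  \sum_(i < Nirr G) \sum_(j < Nirr G)
    (u 0 i * v 0 j) *: KIrr_of_vchar ('chi_i * 'chi_j).

Let io := KIrr_of_vchar.

Let ioD : {in 'Z[irr G] &, {morph io : x y / x + y >-> x + y}}.
Proof.
move=> x y Zx Zy; apply/rowP => k; rewrite !mxE cfdotDl real_floorDzr ?rmorphD ?Cint_cfdot_vchar_irr //.
by rewrite Rreal_int ?Cint_cfdot_vchar_irr.
Qed.

Let ioN : {in 'Z[irr G], {morph io : x / - x}}.
Proof.
move=> x Zx; have ZNx : - x \in 'Z[irr G] by rewrite rpredN.
have io0 : io 0 = 0.
  by apply: (addIr (io 0)); rewrite -ioD ?rpred0 // !add0r.
by apply: (addIr (io x)); rewrite -ioD // !addNr.
Qed.

Let io_irr i : io 'chi_i = 'e_i.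
Proof.
apply/rowP => k; rewrite !mxE cfdot_irr eq_sym eqxx /=.
by case: (k == i); rewrite ?floor1 ?floor0.
Qed.

Let io0 : io 0 = 0.
Proof. by apply: (addIr (io 0)); rewrite -ioD ?rpred0 // !add0r. Qed.

Let ioE phi : phi \in 'Z[irr G] ->
  io phi = \sum_i (Num.floor '[phi, 'chi_i])%:~R *: io 'chi_i.
Proof.
move=> _; rewrite [io phi]row_sum_delta; apply: eq_bigr => i _.
by rewrite io_irr mxE.
Qed.

Let phiE phi : phi \in 'Z[irr G] ->
  phi = \sum_i 'chi_i *~ (Num.floor '[phi, 'chi_i]).
Proof.
move=> Zphi; rewrite {1}[phi]cfun_sum_cfdot; apply: eq_bigr => i _.
by rewrite -scaler_int floorK // Cint_cfdot_vchar_irr.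
Qed.

Let ioMz m : {in 'Z[irr G], forall x, io (x *~ m) = m%:~R *: io x}.
Proof.
move=> x Zx; have ioMn k : io (x *+ k) = k%:R *: io x.
  elim: k => [|k IH]; first by rewrite mulr0n scale0r io0.
  by rewrite mulrS ioD ?rpredMn // IH -addn1 addnC natrD scalerDl scale1r.
case: m => k; first by rewrite -!pmulrn.
rewrite NegzE !mulrNz -!pmulrn ioN ?rpredMn // ioMn.
by rewrite scaleNr.
Qed.

Let io_sum (I : finType) (F : I -> 'CF(G)) :
  (forall i, F i \in 'Z[irr G]) -> io (\sum_i F i) = \sum_i io (F i).
Proof.
move=> ZF; suff [] : (\sum_i F i \in 'Z[irr G]) /\
  io (\sum_i F i) = \sum_i io (F i) by [].
elim/big_rec2: _ => [|i y x _ [Zx IH]]; first by rewrite io0 rpred0.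
by rewrite rpredD // ioD // IH.
Qed.

Let mul_linl v : linear (KIrr_mul^~ v).
Proof.
move=> a x y; rewrite /KIrr_mul scaler_sumr -big_split; apply: eq_bigr => i _.
rewrite scaler_sumr -big_split; apply: eq_bigr => j _ /=.
by rewrite scalerA -scalerDl !mxE mulrDl mulrA.
Qed.

Let mulC : commutative KIrr_mul.
Proof.
move=> u v; rewrite /KIrr_mul exchange_big; apply: eq_bigr => i _.
by apply: eq_bigr => j _; rewrite mulrC ['chi_j * _]mulrC.
Qed.

Let ml v (s : seq (Iirr G)) (c : Iirr G -> K) (F : Iirr G -> KIrr K G) :
  KIrr_mul (\sum_(i <- s) c i *: F i) v = \sum_(i <- s) c i *: KIrr_mul (F i) v.
Proof.
have m0 : KIrr_mul 0 v = 0.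
  by have := mul_linl v (-1) 0 0; rewrite scaler0 addr0 scaleN1r addNr.
elim: s => [|i s IH]; first by rewrite !big_nil.
by rewrite !big_cons mul_linl IH.
Qed.

Let mr v (s : seq (Iirr G)) (c : Iirr G -> K) (F : Iirr G -> KIrr K G) :
  KIrr_mul v (\sum_(i <- s) c i *: F i) = \sum_(i <- s) c i *: KIrr_mul v (F i).
Proof. by rewrite mulC ml; apply: eq_bigr => i _; rewrite mulC. Qed.

Let basisE (u : KIrr K G) : u = \sum_i u 0 i *: io 'chi_i.
Proof.
by rewrite [LHS]row_sum_delta; apply: eq_bigr => i _; rewrite io_irr.
Qed.

Let ioM_irr i j : KIrr_mul (io 'chi_i) (io 'chi_j) = io ('chi_i * 'chi_j).
Proof.
rewrite /KIrr_mul (bigD1 i) //= (bigD1 j) //= !io_irr !mxE !eqxx mulr1 scale1r.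
rewrite [X in _ + X + _]big1 => [|k /negPf nk]; last first.
  by rewrite !mxE nk andbF mulr0 scale0r.
rewrite big1 ?addr0 // => k /negPf nk; rewrite big1 // => l _.
by rewrite !mxE nk andbF mul0r scale0r.
Qed.

Let ioM : {in 'Z[irr G] &, forall x y, KIrr_mul (io x) (io y) = io (x * y)}.
Proof.
move=> x y Zx Zy; rewrite (ioE Zx) (ioE Zy) ml.
rewrite {2}(phiE Zx) mulr_suml io_sum => [|i]; last first.
  by rewrite rpredM // rpredMz // irr_vchar.
apply: eq_bigr => i _; rewrite mr {2}(phiE Zy) mulr_sumr io_sum => [|j]; last first.
  by rewrite rpredM // rpredMz // irr_vchar.
rewrite scaler_sumr; apply: eq_bigr => j _.
rewrite ioM_irr mulrzAl mulrzAr !ioMz ?rpredMz ?rpredM ?irr_vchar //.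
Qed.

Let mulA : associative KIrr_mul.
Proof.
move=> u v w; rewrite (basisE u) !ml; apply: eq_bigr => i _; congr (_ *: _).
rewrite (basisE v) !(ml, mr); apply: eq_bigr => j _; congr (_ *: _).
rewrite (basisE w) !mr; apply: eq_bigr => k _; congr (_ *: _).
by rewrite !(ioM, ioM_irr) ?rpredM ?irr_vchar // mulrA.
Qed.

Let mul1 : left_id KIrr_one KIrr_mul.
Proof.
move=> u; rewrite {2}(basisE u) {1}(basisE u) mr; apply: eq_bigr => i _.
by rewrite /KIrr_one ioM ?cfun1_vchar ?irr_vchar // mul1r.
Qed.

Let mulDl : left_distributive KIrr_mul +%R.
Proof. by move=> x y v; have := mul_linl v 1 x y; rewrite !scale1r. Qed.

Let one_neq0 : KIrr_one != 0.
Proof.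
apply/eqP => /rowP/(_ 0)/eqP; rewrite !mxE -irr0 cfdot_irr eqxx floor1.
by rewrite oner_eq0.
Qed.

HB.instance Definition _ := GRing.Zmodule_isComNzRing.Build (KIrr K G)
  mulA mulC mul1 mulDl one_neq0.

Let scaleAl (a : K) (u v : KIrr K G) : a *: (u * v) = (a *: u) * v.
Proof.
have := mul_linl v a u 0; rewrite addr0 -[RHS]/(a *: (u * v) + 0 * v).
by rewrite mul0r addr0 => <-.
Qed.

HB.instance Definition _ := GRing.Lmodule_isLalgebra.Build K (KIrr K G) scaleAl.
HB.instance Definition _ := GRing.Lalgebra_isComAlgebra.Build K (KIrr K G).
HB.instance Definition _ := Algebra_isFalgebra.Build K (KIrr K G).

(* The canonical map x |-> 1 (x) x. *)
Definition KIrr_of_ZIrr (x : ZIrr G) : KIrr K G := KIrr_of_vchar x.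

Let ofB : zmod_morphism KIrr_of_ZIrr.
Proof.
move=> x y; have [Zx Zy] := (valP x, valP y).
by rewrite /KIrr_of_ZIrr /= -/io ioD ?rpredN // ioN.
Qed.

Let ofM : monoid_morphism KIrr_of_ZIrr.
Proof. by split=> // x y; rewrite /KIrr_of_ZIrr /= -/io -(ioM (valP x) (valP y)). Qed.

HB.instance Definition _ :=
  GRing.isZmodMorphism.Build (ZIrr G) (KIrr K G) KIrr_of_ZIrr ofB.
HB.instance Definition _ :=
  GRing.isMonoidMorphism.Build (ZIrr G) (KIrr K G) KIrr_of_ZIrr ofM.

Lemma KIrr_universal (V : lmodType K) (f : {additive ZIrr G -> V}) :
  exists2 g : {linear KIrr K G -> V},
    forall x, g (KIrr_of_ZIrr x) = f x
  & forall h : {linear KIrr K G -> V},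
      (forall x, h (KIrr_of_ZIrr x) = f x) -> h =1 g.
Proof.
pose X i : ZIrr G := MkZIrr (irr_vchar i).
pose g0 (u : KIrr K G) : V := \sum_i u 0 i *: f (X i).
have g0l : linear g0.
  move=> a u v; rewrite /g0 scaler_sumr -big_split; apply: eq_bigr => i _.
  by rewrite !mxE scalerDl scalerA.
pose gL := GRing.isLinear.Build K (KIrr K G) V _ g0 g0l.
pose g : {linear KIrr K G -> V} := HB.pack g0 gL.
exists g => [x|h hf u]; last first.
  rewrite {1}(basisE u) linear_sum; apply: eq_bigr => i _.
  by rewrite linearZ -[io _]/(KIrr_of_ZIrr (X i)) hf.
have -> : x = \sum_i X i *~ (Num.floor '[zirr_val x, 'chi_i]).
  apply: val_inj; rewrite [LHS](phiE (valP x)) [RHS]raddf_sum.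
  by apply: eq_bigr => i _; rewrite [RHS]raddfMz.
rewrite !raddf_sum; apply: eq_bigr => i _; rewrite !raddfMz; congr (_ *~ _).
rewrite /= /g0 (bigD1 i) //= big1 => [|j /negPf nj].
  by rewrite -/io /KIrr_of_ZIrr /= -/io io_irr !mxE !eqxx scale1r addr0.
by rewrite /KIrr_of_ZIrr /= -/io io_irr !mxE nj andbF scale0r.
Qed.

End KIrrAlgebra.

Section Loewy.
Local Open Scope classical_set_scope.
Variable A : nzRingType.

(* Left ideals of a unital K-algebra are automatically K-subspaces, so the    *)
(* ring-theoretic radical below is the radical of the algebra.               *)
Definition left_ideal (I : set A) : Prop :=
  [/\ I 0, forall x y, I x -> I y -> I (x + y)
    & forall a x, I x -> I (a * x)].

Definition maximal_left_ideal (M : set A) : Prop :=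
  [/\ left_ideal M, M <> setT
    & forall I, left_ideal I -> M `<=` I -> I = M \/ I = setT].

Definition Jacobson_radical : set A :=
  \bigcap_(M in [set M | maximal_left_ideal M]) M.

Definition ideal_mul (I J : set A) : set A :=
  [set x | exists2 s : seq (A * A),
     (forall u, u \in s -> I u.1 /\ J u.2) & x = \sum_(u <- s) u.1 * u.2].

(* The innermost factor is A itself: ideal_exp I 0 = A, and I * A = I for a    *)
(* two-sided ideal I, so this is the usual I^r.                              *)
Definition ideal_exp (I : set A) (r : nat) : set A :=
  iter r (ideal_mul I) setT.

Definition is_Loewy_length (r : nat) : Prop :=
  [/\ (0 < r)%N, ideal_exp Jacobson_radical r = [set 0]
    & forall s, (0 < s)%N -> ideal_exp Jacobson_radical s = [set 0] ->
        (r <= s)%N].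

End Loewy.

(* [pchar K] only contains primes: it is empty in characteristic 0.          *)
Definition has_characteristic (K : fieldType) (p : nat) : Prop :=
  if p == 0%N then [pchar K] =i pred0 else p \in [pchar K].

(* Main.v *)
From HB Require Import structures.
Require Import Defs.
From mathcomp Require Import all_boot all_order all_algebra all_fingroup.
From mathcomp Require Import all_solvable all_field all_character.
From mathcomp Require Import zify.
From mathcomp Require boolp classical_sets.

Set Implicit Arguments.
Unset Strict Implicit.
Unset Printing Implicit Defensive.

Import Order.TTheory GRing.Theory Num.Theory.

(** Write G = W n, let G act on T = signed n, and for w in G let H_w be the
    group of all g in G that map every point into its own w-orbit.  Let phi_w be
    the character of G on the cosets of H_w.

    _Spanning._  The phi_w, with w running over representatives of the classes,
    form a Z-basis of Z Irr G (vchar_block_char).  The proof exhibits a dual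
    family: a ranking of w numbers the points of each cycle of w in such a way
    that x and -x have the same rank; psi_w is induced from a sign character of
    the stabiliser of the ranking.  By Mackey, phi_v and psi_w can only fail to
    be orthogonal if some conjugate of v has orbits transversal to the levels of
    the ranking, and then the total rank of v is at most that of w, with
    equality only if v and w are conjugate (ranking_conj); moreover
    [phi_w, psi_w] = 1.  So the matrix of inner products is integral and
    unitriangular (dual_characters).  In particular the characters of G have
    integer values, and evaluation at g is a ring morphism K Irr G -> K, which
    vanishes on the radical.

    _Radical._  If phi_w occurs in an element of the radical, then the index of
    H_w in its normaliser is zero in K: otherwise take such a w with H_w of
    maximal order and evaluate at w; phi_w takes there the value of that index,
    and all the other terms vanish.  In characteristic 0 the radical is
    therefore 0.

    _Upper bound._  Let p > 0 be the characteristic, and let F_j be the span of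
    the characters on the cosets of the subgroups L, defined by their orbits
    on T, such that N / L is abelian of order p ^ j for some N <= G normalising
    L.  By Cauchy's theorem the radical lies in F_1.  In the Mackey formula for
    the product of two such characters, grouped by double cosets of the groups
    N, each coefficient is a power of p, which is 1 only for the terms that
    belong to F_(i+j) (permchar_mul_normal); so F_i F_j is contained in F_(i+j)
    and the r-th power of the radical in F_r.  Finally N / L permutes the orbits
    of L faithfully, and an abelian group of order p ^ j that acts faithfully on
    m points satisfies p j <= m (abelian_action_bound).  As L has at most 2n
    orbits, and for odd p the group N / L acts faithfully already on the at most
    n pairs of opposite orbits, F_r = 0 as soon as r > n if p = 2, and as soon
    as r > [n/p] if p > 2.

    _Lower bound._  Let x be the character of G on T, X its image in K Irr G.  The
    value x(g) is an even number 2a with a <= n, and a = n only for g = 1.  So the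
    product of the x - 2i for i < n is supported at 1; it is the regular
    character because |G| >= 2 ^ n n!, hence its image in K Irr G is not 0,
    whereas one more factor gives 0.  In K Irr G the factors X - 2i only depend on
    i modulo q, where q = p for odd p and q = 1 for p = 2, so the product f of
    the first q factors is nilpotent and f ^ [n/q] is not 0. *)

(** * Jacobson radical of a commutative ring *)

Section RingRadical.
Import classical_sets.
Local Open Scope group_scope.
Local Open Scope ring_scope.
Variable A : comNzRingType.

(** If a maximal ideal M missed f, then 1 = y + a f with y in M, and the
    geometric series in a f, which is finite, inverts y. *)
Lemma nilpotent_Jacobson_radical (f : A) m :
  f ^+ m = 0 -> Jacobson_radical f.
Proof.
move=> fm0 M [[M0 MD MM] Mproper Mmax].
pose I : set A := fun x => exists2 y, M y & exists a, x = y + a * f.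
have idI : left_ideal I.
  split=> [|x y [x1 Mx [a ->]] [y1 My [b ->]]|a x [x1 Mx [b ->]]].
  - by exists 0 => //; exists 0; rewrite mul0r addr0.
  - exists (x1 + y1); first exact: MD.
    by exists (a + b); rewrite mulrDl addrACA.
  - exists (a * x1); first exact: MM.
    by exists (a * b); rewrite mulrDr mulrA.
have sMI : (M `<=` I)%classic.
  by move=> x Mx; exists x => //; exists 0; rewrite mul0r addr0.
have [IM|IT] := Mmax I idI sMI.
  by rewrite -IM; exists 0 => //; exists 1; rewrite mul1r add0r.
have [y My [a ya]] : I 1 by rewrite IT.
case: Mproper; apply/seteqP; split=> // x _.
suff M1 : M 1 by rewrite -[x]mulr1; apply: MM.
have yE : y = 1 - a * f by rewrite ya addrK.
have -> : 1 = (\sum_(i < m) (a * f) ^+ i) * y.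
  have afm : (a * f) ^+ m = 0 by rewrite exprMn fm0 mulr0.
  rewrite yE mulrC -[LHS]subr0 -[X in _ - X]afm -[X in X - _](expr1n _ m) subrXX.
  by congr (_ * _); apply: eq_bigr => i _; rewrite expr1n mul1r.
exact: MM.
Qed.

Lemma ideal_exp_mem (I : set A) f r : I f -> ideal_exp I r (f ^+ r).
Proof.
move=> If; elim: r => [|r IHr] //; rewrite exprS.
exists [:: (f, f ^+ r)]; last by rewrite big_seq1.
by move=> u; rewrite inE => /eqP ->.
Qed.

Lemma ideal_exp0 (I : set A) r : I 0 -> ideal_exp I r 0.
Proof. by case: r => [|r] I0 //; exists [::]; rewrite ?big_nil. Qed.

End RingRadical.

(** * Scalar extension of the character ring *)

Section ScalarExtension.
Local Open Scope group_scope.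
Local Open Scope ring_scope.
Variables (K : fieldType) (gT : finGroupType) (G : {group gT}).
Local Notation A := (KIrr K G).
Local Notation io := (@KIrr_of_vchar K gT G).

Lemma KIrr_of_vcharE phi (Zphi : phi \in 'Z[irr G]) :
  io phi = KIrr_of_ZIrr K (MkZIrr Zphi).
Proof. by []. Qed.

Lemma KIrr_of_vchar_sum (I : Type) (s : seq I) (a : I -> int) (F : I -> 'CF(G)) :
  (forall i, F i \in 'Z[irr G]) ->
  io (\sum_(i <- s) (a i)%:~R *: F i) = \sum_(i <- s) (a i)%:~R *: io (F i).
Proof.
move=> ZF; pose X i := MkZIrr (ZF i).
have E : \sum_(i <- s) (a i)%:~R *: F i = val (\sum_(i <- s) X i *~ a i).
  rewrite raddf_sum; apply: eq_bigr => i _.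
  by rewrite raddfMz scaler_int.
transitivity (KIrr_of_ZIrr K (\sum_(i <- s) X i *~ a i)).
  by rewrite /KIrr_of_ZIrr -[zirr_val _]/(val _) -E.
rewrite raddf_sum; apply: eq_bigr => i _.
by rewrite raddfMz scaler_int.
Qed.

Lemma KIrr_of_vcharM phi psi : phi \in 'Z[irr G] -> psi \in 'Z[irr G] ->
  io (phi * psi) = io phi * io psi.
Proof.
move=> Zphi Zpsi; have Z := rpredM Zphi Zpsi.
rewrite !(KIrr_of_vcharE Z, KIrr_of_vcharE Zphi, KIrr_of_vcharE Zpsi).
by rewrite -rmorphM; congr KIrr_of_ZIrr; apply: val_inj.
Qed.

Lemma KIrr_of_vchar_irr i : io 'chi_i = delta_mx 0 i.
Proof.
apply/rowP => k; rewrite !mxE cfdot_irr eqxx eq_sym.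
by case: (k == i); rewrite ?floor1 ?floor0.
Qed.

Lemma KIrr_sum_irr (u : A) : u = \sum_i u 0 i *: io 'chi_i.
Proof.
rewrite [LHS]row_sum_delta; apply: eq_bigr => i _.
by rewrite KIrr_of_vchar_irr.
Qed.

Lemma KIrr_of_vchar_coord phi i :
  io phi 0 i = (Num.floor '[phi, 'chi_i])%:~R.
Proof. by rewrite mxE. Qed.

End ScalarExtension.

Section Evaluation.
Import classical_sets.
Local Open Scope group_scope.
Local Open Scope ring_scope.
Variables (K : fieldType) (gT : finGroupType) (G : {group gT}).
Local Notation A := (KIrr K G).
Local Notation io := (@KIrr_of_vchar K gT G).
Hypothesis Zirr : forall (phi : 'CF(G)) x, phi \in 'Z[irr G] -> phi x \in Num.int.

(** The ring morphism 1 (x) chi |-> chi(x), when all the values of the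
    characters are integers; Num.floor only changes the type. *)
Definition KIrr_eval (x : gT) (u : A) : K :=
  \sum_k u 0 k * (Num.floor ('chi[G]_k x))%:~R.

Lemma KIrr_eval_linear x : linear_for *%R (KIrr_eval x).
Proof.
move=> a u v; rewrite /KIrr_eval mulr_sumr -big_split /=.
by apply: eq_bigr => k _; rewrite !mxE mulrDl mulrA.
Qed.

HB.instance Definition _ x :=
  GRing.isLinear.Build K (KIrr K G) K *%R (KIrr_eval x) (KIrr_eval_linear x).

Lemma KIrr_eval_vchar x phi : phi \in 'Z[irr G] ->
  KIrr_eval x (io phi) = (Num.floor (phi x))%:~R.
Proof.
move=> Zphi; rewrite /KIrr_eval.
have -> : phi x = (\sum_k Num.floor '[phi, 'chi_k] * Num.floor ('chi_k x))%:~R.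
  rewrite rmorph_sum {1}[phi]cfun_sum_cfdot sum_cfunE; apply: eq_bigr => k _.
  rewrite cfunE /= intrM !floorK ?Cint_cfdot_vchar_irr //.
  by apply: Zirr; rewrite irr_vchar.
rewrite intrKfloor rmorph_sum.
by apply: eq_bigr => k _; rewrite KIrr_of_vchar_coord /= intrM.
Qed.

Lemma KIrr_evalM x u v : KIrr_eval x (u * v) = KIrr_eval x u * KIrr_eval x v.
Proof.
have E w : KIrr_eval x w = \sum_k w 0 k * KIrr_eval x (io 'chi_k).
  by rewrite {1}[w]KIrr_sum_irr linear_sum; apply: eq_bigr => k _; rewrite linearZ.
rewrite -[u * v]/(\sum_i \sum_j (u 0 i * v 0 j) *: io ('chi_i * 'chi_j)).
rewrite linear_sum [KIrr_eval x u]E mulr_suml; apply: eq_bigr => i _.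
rewrite linear_sum [KIrr_eval x v]E mulr_sumr; apply: eq_bigr => j _.
rewrite linearZ mulrACA /=; congr (_ * _).
rewrite !KIrr_eval_vchar ?rpredM ?irr_vchar // cfunE -intrM.
by rewrite floorM // Zirr ?irr_vchar.
Qed.

Lemma KIrr_eval1 x : x \in G -> KIrr_eval x 1 = 1.
Proof.
move=> Gx; rewrite -[1 in LHS]/(io 1) KIrr_eval_vchar ?cfun1_vchar //.
by rewrite cfun1E Gx floor1.
Qed.

(** The kernel of evaluation at x is a maximal ideal, as K is a field. *)
Lemma Jacobson_radical_eval x u : x \in G ->
  Jacobson_radical u -> KIrr_eval x u = 0.
Proof.
move=> Gx Ju; pose M : set A := fun v => KIrr_eval x v = 0.
suff: M u by [].
apply: Ju; split.
- split=> [//|v w|a v]; rewrite /M ?linear0 // ?linearD ?KIrr_evalM /= => -> //.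
    by move=> ->; rewrite addr0.
  by rewrite mulr0.
- move=> MT; have /eqP : M 1 by rewrite MT.
  by rewrite KIrr_eval1 // oner_eq0.
move=> I [I0 ID IM] sMI.
have [[v [Iv nzv]]|noI] := boolp.pselect (exists v, I v /\ KIrr_eval x v <> 0).
  right; apply/seteqP; split=> // w _.
  pose c := KIrr_eval x w / KIrr_eval x v.
  have -> : w = (c *: 1) * v + (w - c *: v) by rewrite -scalerAl mul1r subrKC.
  apply: ID; first exact: IM.
  apply: sMI; rewrite /M linearB linearZ /= divfK ?subrr //.
  exact/eqP.
left; apply/seteqP; split=> // v Iv.
by apply: boolp.contrapT => nzv; apply: noI; exists v.
Qed.

End Evaluation.

(** * Products of transitive permutation characters *)

Section TransitivePermChar.
Local Open Scope group_scope.
Local Open Scope ring_scope.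
Variables (gT : finGroupType) (G : {group gT}).
Implicit Types H L : {group gT}.

Definition permchar (L : {group gT}) : 'CF(G) := 'Ind[G, L] 1.

Lemma permcharE L x : L \subset G ->
  permchar L x = #|L|%:R^-1 * \sum_(y in G) ((x ^ y)%g \in L)%:R.
Proof.
move=> sLG; rewrite /permchar cfIndE //; congr (_ * _).
by apply: eq_bigr => y _; rewrite cfun1E.
Qed.

Lemma permchar_vchar L : permchar L \in 'Z[irr G].
Proof. by rewrite cfInd_vchar ?cfun1_vchar. Qed.

Lemma permcharJ L y : L \subset G -> y \in G ->
  permchar (L :^ y)%G = permchar L.
Proof.
move=> sLG Gy; apply/cfunP => x.
have sLyG : ((L :^ y)%G \subset G)%g by rewrite /= -(conjGid Gy) conjSg.
rewrite (permcharE x sLyG) permcharE // cardJg; congr (_ * _).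
rewrite [RHS](reindex_inj (mulIg y^-1)%g) /=.
apply: eq_big => [z|z _]; first by rewrite groupMr ?groupV.
by rewrite conjgM -mem_conjg.
Qed.

(** The quotient of the normaliser by L acts freely on the fixed points of x in
    G / L. *)
Lemma permchar_norm L x : L \subset G ->
  exists m, permchar L x = (#|'N_G(L) : L|%g * m)%:R.
Proof.
move=> sLG; pose A := [set y in G | (x ^ y)%g \in L]; pose N := 'N_G(L)%G.
have sLN : L \subset N by rewrite subsetI sLG normG.
have AN y z : z \in N -> ((y * z)%g \in A) = (y \in A).
  case/setIP=> Gz nLz; rewrite !inE groupMr //; congr (_ && _).
  by rewrite conjgM memJ_norm.
(* A is a union of left cosets of N. *)
have cA : #|A| = (#|[set (y *: N)%g | y in A]| * #|N|)%N.
  rewrite -sum1_card (partition_big_imset (fun y => y *: N)%g) /= -sum_nat_const.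
  apply: eq_bigr => _ /imsetP[y Ay ->]; rewrite sum1_card -(card_lcoset N y).
  apply: eq_card => z; rewrite [LHS]inE; apply/andP/idP => [[_ /eqP <-]|].
    exact: lcoset_refl.
  case/lcosetP=> t Nt ->; rewrite [_ \in A]AN //; split=> //.
  by rewrite lcosetM lcoset_id.
move: #|[set _ | y in A]| cA => m cA; exists m; rewrite permcharE // -natr_sum.
have -> : (\sum_(y in G) ((x ^ y)%g \in L) = #|A|)%N.
  rewrite -sum1_card [RHS](eq_bigl (fun y => (y \in G) && ((x ^ y)%g \in L))) => [|y].
    by rewrite [RHS]big_mkcondr; apply: eq_bigr => y _; case: (_ \in L).
  by rewrite inE.
have nzL : (#|L|%:R : algC) != 0 by rewrite pnatr_eq0 -lt0n cardG_gt0.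
by rewrite cA -(Lagrange sLN) mulnC -mulnA natrM mulKf.
Qed.

(** Mackey's formula, summed over all the elements of G instead of double
    cosets. *)
Lemma permchar_mul H L : H \subset G -> L \subset G ->
  permchar H * permchar L =
  \sum_(g in G) (#|(H :^ g :&: L)%g|%:R / (#|H| * #|L|)%:R) *:
    permchar (H :^ g :&: L)%G.
Proof.
move=> sHG sLG; apply/cfunP => x; rewrite cfunE sum_cfunE !permcharE //.
have sI g : ((H :^ g :&: L)%G \subset G)%g by rewrite subIset ?sLG ?orbT.
transitivity (((#|H| * #|L|)%:R)^-1 *
    \sum_(g in G) \sum_(z in G) ((x ^ z)%g \in (H :^ g :&: L)%g)%:R : algC).
  rewrite natrM invfM mulrACA; congr (_ * _).
  rewrite mulr_suml; under eq_bigr do rewrite mulr_sumr.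
  rewrite exchange_big [RHS]exchange_big /=; apply: eq_bigr => z Gz.
  rewrite (reindex_inj (mulgI z)) (reindex_inj invg_inj) /=.
  apply: eq_big => [g|g _]; first by rewrite groupMl // groupV.
  rewrite inE mem_conjg conjgM; do 2!case: (_ \in _);
    by rewrite ?mulr1 ?mul0r ?mulr0.
rewrite mulr_sumr; apply: eq_bigr => g _.
rewrite cfunE permcharE // mulrACA divff ?mul1r //.
by rewrite pnatr_eq0 -lt0n cardG_gt0.
Qed.

(** The quotient of M :&: N embeds into the product of M / H and N / L. *)
Lemma dvdn_index_capN (H L M N : {group gT}) : H <| M -> L <| N ->
  (#|M :&: N : H :&: L|%g %| #|M : H|%g * #|N : L|%g)%N.
Proof.
have dvd (P Q R : {group gT}) : P <| Q -> R \subset Q ->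
    (#|R : P :&: R|%g %| #|Q : P|%g)%N.
  case/andP=> sPQ nPQ sRQ; rewrite setIC indexgI.
  rewrite -!card_quotient ?(subset_trans sRQ) //.
  by rewrite cardSg ?quotientS.
move=> nHM nLN.
have sHM := normal_sub nHM; have sLN := normal_sub nLN.
rewrite -(@Lagrange_index _ (M :&: N) (H :&: N) (H :&: L)) ?setSI ?setIS //.
apply: dvdn_mul.
  have := dvd H M (M :&: N)%G nHM (subsetIl _ _).
  by rewrite /= setIA (setIidPl sHM).
have := dvd L N (H :&: N)%G nLN (subsetIr _ _).
by rewrite /= setICA (setIidPl sLN).
Qed.

Lemma card_double_coset (M N : {group gT}) g :
  (#|M :* g * N|%g * #|M :^ g :&: N|%g = #|M| * #|N|)%N.
Proof.
rewrite -(cardJg M g) mul_cardG; congr (_ * _)%N.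
by rewrite /= conjsgE -[in RHS](card_lcoset _ g) !mulgA mulg_set1 mulgV mul1g.
Qed.

(** Mackey's formula grouped by double cosets of the larger groups M and N.
    The terms of the double coset of g agree up to conjugation. That coset has
    |M| |N| / |M ^ g :&: N| elements, which turns the coefficient into the
    index by which the quotient of M ^ g :&: N falls short of the product of M
    / H and N / L. *)
Lemma permchar_mul_normal (H L M N : {group gT}) :
  M \subset G -> N \subset G -> H <| M -> L <| N ->
  permchar H * permchar L =
  \sum_(D in [set M :* g * N | g in G]%g)
    (#|M : H|%g * #|N : L|%g %/
      #|M :^ (repr D) :&: N : H :^ (repr D) :&: L|%g)%N%:R
    *: permchar (H :^ (repr D) :&: L)%G.
Proof.
move=> sMG sNG nHM nLN.
have [sHM nMH] := andP nHM; have [sLN nNL] := andP nLN.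
have [sHG sLG] := (subset_trans sHM sMG, subset_trans sLN sNG).
rewrite permchar_mul //.
rewrite (partition_big_imset (fun g => M :* g * N)%g) /=.
apply: eq_bigr => D /imsetP[g0 Gg0 defD].
have Did g : (M :* g * N == D)%g = (g \in D).
  apply/eqP/idP => [<-|].
    by rewrite -[X in X \in _]mulg1 mem_mulg ?rcoset_refl.
  rewrite defD => /mulsgP[_ n /rcosetP[m Mm ->] Nn ->].
  by rewrite !rcosetM rcoset_id // -mulgA lcoset_id.
have sDG : (D \subset G)%g.
  by rewrite defD -(mulGid G) mulgSS ?mul_subG ?sub1set.
set g := repr D.
have Dg : g \in D.
  by apply: (mem_repr g0); rewrite -Did defD.
have Gg := subsetP sDG _ Dg.
have defDg : (M :* g * N = D)%g by apply/eqP; rewrite Did.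
rewrite (eq_bigr (fun=> (#|(H :^ g :&: L)%g|%:R / (#|H| * #|L|)%:R) *:
   permchar (H :^ g :&: L)%G)); last first.
  move=> h /andP[Gh]; rewrite Did -defDg => /mulsgP[_ n /rcosetP[m Mm ->] Nn ->].
  have E : (H :^ (m * g * n) :&: L = (H :^ g :&: L) :^ n)%g.
    by rewrite conjIg !conjsgM (normsP nMH) // (normsP nNL).
  have sIG : (H :^ g :&: L)%G \subset G by rewrite subIset ?sLG ?orbT.
  rewrite E cardJg -(permcharJ sIG (subsetP sNG _ Nn)).
  by congr (_ *: permchar _); apply: group_inj.
rewrite (eq_bigl [in D]) => [|h]; last first.
  by rewrite Did andb_idl //; apply: subsetP.
rewrite sumr_const -scaler_nat scalerA mulrA; congr (_ *: _).
have sLN' : (H :^ g :&: L)%G \subset (M :^ g :&: N)%G by rewrite setISS ?conjSg.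
have nHMg : (H :^ g)%G <| (M :^ g)%G by rewrite normalJ.
have := dvdn_index_capN nHMg nLN; rewrite /= indexJg => /dvdnP[q defq].
have := card_double_coset M N g; rewrite defDg.
rewrite -(Lagrange sHM) -(Lagrange sLN) -(Lagrange sLN') /= => cardD.
rewrite defq mulnK ?indexg_gt0 //.
have -> : (q%:R : algC) = ((#|H| * #|L|) * q)%:R / (#|H| * #|L|)%:R.
  by rewrite natrM mulrC mulKf // pnatr_eq0 -lt0n muln_gt0 !cardG_gt0.
rewrite -natrM; congr (_%:R / _); apply/eqP.
rewrite -(eqn_pmul2r (indexg_gt0 (M :^ g :&: N)%G (H :^ g :&: L)%G)) /=.
by rewrite -[X in _ == X]mulnA -defq -mulnA cardD mulnACA.
Qed.

End TransitivePermChar.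

(** * The filtration by abelian rank *)

Section RankFiltration.
Local Open Scope group_scope.
Local Open Scope ring_scope.
Variables (K : fieldType) (gT : finGroupType) (G : {group gT}) (p : nat).
Variable C : pred {group gT}.
Hypothesis pK : p \in [pchar K].
Hypothesis CJ : forall L g, g \in G -> C L -> C (L :^ g)%G.
Hypothesis CI : forall H L, C H -> C L -> C (H :&: L)%G.
Implicit Types H L M N : {group gT}.
Local Notation io := (@KIrr_of_vchar K gT G).

(** The condition says that an abelian group of order p ^ j acts freely on the
    cosets of L in G and commutes with G. *)
Definition has_abelian_rank j L :=
  C L && [exists N : {group gT},
    [&& N \subset G, L <| N, abelian (N / L)%g & #|N : L|%g == (p ^ j)%N]].

Definition rank_space j : {vspace KIrr K G} :=
  (\sum_(L : {group gT} | has_abelian_rank j L) <[io (permchar G L)]>)%VS.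

Lemma rank_space_mem j L : has_abelian_rank j L ->
  io (permchar G L) \in rank_space j.
Proof. by move=> rL; apply/(subvP (sumv_sup L rL (subvv _)))/memv_line. Qed.

(** The coefficients of the grouped Mackey formula are powers of p. Those
    different from 1 vanish in K; where the coefficient is 1, the quotient of
    M ^ g :&: N has order p ^ (i + j), and it is abelian since its derived
    group lies in both H ^ g and L. *)
Lemma has_abelian_rank_mul H L i j :
  has_abelian_rank i H -> has_abelian_rank j L ->
  io (permchar G H * permchar G L) \in rank_space (i + j).
Proof.
case/andP=> CH /existsP[M /and4P[sMG nHM abM /eqP oM]].
case/andP=> CL /existsP[N /and4P[sNG nLN abN /eqP oN]].
rewrite (permchar_mul_normal sMG sNG nHM nLN).
pose a D := (#|M : H|%g * #|N : L|%g %/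
      #|M :^ (repr D) :&: N : H :^ (repr D) :&: L|%g)%N.
rewrite (eq_bigr (fun D => (a D)%:Z%:~R *: permchar G (H :^ (repr D) :&: L)%G)) //.
rewrite -big_enum KIrr_of_vchar_sum => [|D]; last exact: permchar_vchar.
rewrite big_enum; apply: memv_suml => D /imsetP[g0 Gg0 defD].
set g := repr D.
have Gg : g \in G.
  have Dg : g \in D.
    by apply: (mem_repr g0); rewrite defD -[X in X \in _]mulg1 mem_mulg ?rcoset_refl.
  suff /subsetP sDG : D \subset G by apply: sDG.
  by rewrite defD -(mulGid G) mulgSS ?mul_subG ?sub1set.
have nHMg : (H :^ g)%G <| (M :^ g)%G by rewrite normalJ.
have := dvdn_index_capN nHMg nLN; rewrite /= indexJg oM oN -expnD => dvd_pk.
have p_pr : prime p by case/andP: pK.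
have [k le_kij ok] := dvdn_pfactor _ _ p_pr dvd_pk.
have -> : a D = (p ^ (i + j - k))%N.
  rewrite /a oM oN ok -expnD -[in LHS](subnK le_kij) expnD mulnK //.
  by rewrite expn_gt0 prime_gt0.
have [lt_kij|ge_kij] := ltnP k (i + j)%N.
  have -> : ((p ^ (i + j - k))%N%:Z%:~R : K) = 0.
    by rewrite -pmulrn natrX (pcharf0 pK) expr0n subn_eq0 leqNgt lt_kij.
  by rewrite scale0r mem0v.
have -> : (i + j = k)%N by apply/eqP; rewrite eqn_leq ge_kij.
apply/memvZ/rank_space_mem/andP; split; first by rewrite CI ?CJ.
apply/existsP; exists (M :^ g :&: N)%G.
rewrite ok eqxx andbT subIset ?sNG ?orbT //=.
have nMgN : M :^ g :&: N \subset 'N(H :^ g :&: L).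
  rewrite normsI //; first exact: subset_trans (subsetIl _ _) (normal_norm nHMg).
  exact: subset_trans (subsetIr _ _) (normal_norm nLN).
apply/andP; split.
  by apply/andP; split; first by rewrite setISS ?(normal_sub nHMg) ?normal_sub.
rewrite sub_der1_abelian // subsetI.
rewrite (subset_trans (dergS 1 (subsetIl _ _))) /=; last first.
  by rewrite derJ conjSg der1_min ?normal_norm.
by rewrite (subset_trans (dergS 1 (subsetIr _ _))) // der1_min ?normal_norm.
Qed.

Lemma rank_space_mul i j u v : u \in rank_space i -> v \in rank_space j ->
  u * v \in rank_space (i + j).
Proof.
move=> /memv_sumP[u_ uP ->] /memv_sumP[v_ vP ->].
rewrite mulr_suml memv_suml // => H rH; rewrite mulr_sumr memv_suml // => L rL.
have /vlineP[c ->] := uP H rH; have /vlineP[d ->] := vP L rL.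
rewrite -scalerAl -scalerAr !memvZ // -KIrr_of_vcharM ?permchar_vchar //.
exact: has_abelian_rank_mul.
Qed.

Lemma ideal_exp_rank_space r :
  (forall u : KIrr K G, Jacobson_radical u -> u \in rank_space 1) ->
  rank_space 0 = fullv ->
  forall u : KIrr K G, ideal_exp (@Jacobson_radical (KIrr K G)) r u ->
  u \in rank_space r.
Proof.
move=> sJ1 all0; elim: r => [|r IHr] u /=; first by rewrite all0 memvf.
case=> s sP ->; rewrite big_seq memv_suml // => -[x y] /sP[/= Jx Iy].
by rewrite -add1n rank_space_mul ?sJ1 ?IHr.
Qed.

End RankFiltration.

(** * Faithful actions of abelian groups *)

Section AbelianAction.
Local Open Scope group_scope.
Variables (aT : finGroupType) (sT : finType) (to : {action aT &-> sT}) (p : nat).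
Hypothesis p_pr : prime p.

(** Induction on S. A nontrivial orbit O has p ^ i points with i > 0, hence at
    least p i. As the acting group is abelian, the stabiliser of one point of
    O fixes O pointwise, so it acts faithfully on the rest of S, and its order
    is p ^ (k - i). *)
Lemma abelian_action_bound (N : {group aT}) (S : {set sT}) k :
  [acts N, on S | to] -> N^`(1) \subset 'C(S | to) ->
  #|N : 'C_N(S | to)| = (p ^ k)%N -> (p * k <= #|S|)%N.
Proof.
have [m leSm] := ubnP #|S|; elim: m => // m IHm in N S k leSm *.
move=> actsN derN oN; have [cNS|] := boolP (N \subset 'C(S | to)).
  suff -> : k = 0%N by rewrite muln0.
  move/eqP: oN; rewrite (setIidPl cNS) indexgg eq_sym.
  by rewrite -[X in _ == X](expn0 p) eqn_exp2l ?prime_gt1 // => /eqP.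
case/subsetPn=> a Na nfix.
have /exists_inP[x Sx nxa] : [exists x in S, to x a != x].
  apply: contraR nfix => /exists_inPn fixS; apply/astabP => y Sy.
  by apply/eqP; have := fixS y Sy; rewrite negbK.
set O := orbit to N x; pose M := 'C_N[x | to]%G.
have sOS : O \subset S by rewrite acts_sub_orbit.
have sCM : 'C_N(S | to) \subset M.
  by rewrite setIS // astabS // sub1set.
have := oN; rewrite -(Lagrange_index (subsetIl N _) sCM) /= -card_orbit => oOM.
have /(dvdn_pfactor _ _ p_pr)[i le_ik oO] : (#|O| %| p ^ k)%N.
  by rewrite -oOM dvdn_mulr.
have i_gt0 : (0 < i)%N.
  rewrite lt0n; apply: contraNneq nxa => i0.
  have /cards1P[y Oy] : #|O| == 1%N by rewrite oO i0.
  have : to x a \in O by rewrite mem_orbit.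
  by have := orbit_refl to N x; rewrite -/O Oy !inE => /eqP -> /eqP ->.
have oM : #|M : 'C_N(S | to)| = (p ^ (k - i))%N.
  apply/eqP; rewrite -(eqn_pmul2l (_ : 0 < p ^ i)%N) ?expn_gt0 ?prime_gt0 //.
  by rewrite -expnD subnKC // -oOM oO.
have derNy y b : y \in S -> b \in N^`(1) -> to y b = y.
  by move=> Sy Nb; have /astabP := subsetP derN b Nb; apply.
(* Each point of O is the image of x by some b, and c commutes with b modulo
   the derived group, which acts trivially. *)
have defC : 'C_M(S :\: O | to) = 'C_N(S | to).
  apply/setP => c; apply/idP/idP.
    case/setIP=> /setIP[Nc /astab1P xc] /astabP fixc.
    rewrite inE Nc; apply/astabP => y Sy.
    have [/orbitP[b Nb defy]|nOy] := boolP (y \in O); last first.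
      by rewrite fixc // inE nOy.
    have -> : to y c = to x (b * c) by rewrite actM defy.
    rewrite commgC (actM _ _ (c * b)) (actM _ _ c) xc defy derNy //.
    exact: mem_commg.
  move=> Cc; rewrite inE (subsetP sCM) //=.
  by apply: subsetP Cc; rewrite subIset ?astabS ?orbT ?subsetDl.
have sMN : M \subset N := subsetIl _ _.
have leM : (p * (k - i) <= #|S :\: O|)%N.
  apply: (IHm M).
  - rewrite -ltnS; apply: leq_trans leSm; rewrite ltnS.
    by rewrite -(cardsID O S) (setIidPr sOS) -[X in (X < _)%N]add0n ltn_add2r oO
      expn_gt0 prime_gt0.
  - by rewrite actsD ?(subset_trans sMN) ?acts_orbit ?subsetT.
  - apply: subset_trans (dergS 1 sMN) (subset_trans derN _).
    by rewrite astabS ?subsetDl.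
  by rewrite defC.
rewrite -(subnK le_ik) mulnDr -(cardsID O S) (setIidPr sOS) addnC oO.
rewrite leq_add // -{2}(prednK i_gt0) expnS leq_pmul2l ?prime_gt0 //.
by rewrite -{1}(prednK i_gt0) ltn_expl ?prime_gt1.
Qed.

End AbelianAction.

(** * Subgroups of the hyperoctahedral group defined by their orbits *)

Section BlockClosed.
Local Open Scope group_scope.
Variable n : nat.
Implicit Types (L N : {group {perm signed n}}) (g w : {perm signed n}).
Implicit Types x y : signed n.

Lemma soppK : involutive (@sopp n).
Proof. by case=> i b; rewrite /sopp /= negbK. Qed.

Lemma sopp_neq x : sopp x != x.
Proof. by case: x => i []; rewrite /sopp /eq_op /= andbF. Qed.

Lemma W_sopp g x : g \in W n -> g (sopp x) = sopp (g x).
Proof. by rewrite inE => /forallP/(_ x)/eqP. Qed.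

Lemma W_mem g : (forall x, g (sopp x) = sopp (g x)) -> g \in W n.
Proof. by move=> Wg; rewrite inE; apply/forallP => x; rewrite Wg. Qed.

Lemma orbit_permP L x y :
  reflect (exists2 g, g \in L & g x = y) (y \in orbit 'P L x).
Proof. by apply: (iffP orbitP) => -[g Lg gx]; exists g. Qed.

(** L is the full group of those g in W n that map each orbit of L to itself;
    such an L is determined by a partition of the signed points, and the
    property is stable under conjugation and intersection. *)
Definition block_closed L := (L \subset W n) &&
  [forall g in W n, [forall x, g x \in orbit 'P L x] ==> (g \in L)].

Lemma block_closedP L g : block_closed L -> g \in W n ->
  (forall x, g x \in orbit 'P L x) -> g \in L.
Proof.
case/andP=> _ /forall_inP clL Wg Lg; have /implyP := clL g Wg; apply.
exact/forallP.
Qed.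

Lemma block_closedJ L g : g \in W n -> block_closed L -> block_closed (L :^ g)%G.
Proof.
move=> Wg clL; have [sLW _] := andP clL; apply/andP; split.
  by rewrite -(conjGid Wg) conjSg.
apply/forall_inP => h Wh; apply/implyP => /forallP Lh.
rewrite mem_conjg; apply: block_closedP => //; first by rewrite groupJ ?groupV.
move=> x; have /orbit_permP[k] := Lh (g x).
rewrite mem_conjg => Lk kgx; apply/orbit_permP; exists (k ^ g^-1) => //.
by rewrite !conjgE !invgK !permM kgx.
Qed.

Lemma block_closedI L N : block_closed L -> block_closed N ->
  block_closed (L :&: N)%G.
Proof.
move=> clL clN; apply/andP; split; first by rewrite subIset ?(andP clL).1.
apply/forall_inP => h Wh; apply/implyP => /forallP Lh.
rewrite inE; apply/andP; split; apply: block_closedP => // x;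
  by apply: subsetP (Lh x); rewrite imsetS ?subsetIl ?subsetIr.
Qed.

(** The largest subgroup of W n with the same orbits as w. *)
Definition block_group_set w : {set {perm signed n}} :=
  [set g in W n | [forall x, g x \in porbit w x]].

Lemma block_groupE w g :
  (g \in block_group_set w) = (g \in W n) && [forall x, g x \in porbit w x].
Proof. by rewrite inE. Qed.

Lemma block_group_is_group w : group_set (block_group_set w).
Proof.
apply/group_setP; split=> [|g h].
  by rewrite block_groupE group1; apply/forallP => x; rewrite perm1 porbit_id.
rewrite !block_groupE => /andP[Wg /forallP Bg] /andP[Wh /forallP Bh].
rewrite groupM //; apply/forallP => x; rewrite permM.
have := Bh (g x); rewrite -!eq_porbit_mem => /eqP ->.
by rewrite eq_porbit_mem.
Qed.
Canonical block_group w := Group (block_group_is_group w).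

Lemma mem_block_group w : w \in W n -> w \in block_group w.
Proof.
move=> Ww; rewrite block_groupE Ww; apply/forallP => x.
exact: (mem_porbit w 1 x).
Qed.

Lemma block_group_sub w : block_group w \subset W n.
Proof. by apply/subsetP => g; rewrite block_groupE => /andP[]. Qed.

Lemma orbit_block_group w x : w \in W n -> orbit 'P (block_group w) x = porbit w x.
Proof.
move=> Ww; apply/setP => y; apply/orbit_permP/idP.
  by case=> g; rewrite block_groupE => /andP[_ /forallP/(_ x) wgx] <-.
by case/porbitP=> i ->; exists (w ^+ i) => //; rewrite groupX ?mem_block_group.
Qed.

Lemma block_group_closed w : w \in W n -> block_closed (block_group w).
Proof.
move=> Ww; rewrite /block_closed block_group_sub; apply/forall_inP => g Wg.
apply/implyP => /forallP wg; rewrite block_groupE Wg; apply/forallP => x.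
by rewrite -orbit_block_group.
Qed.

Lemma porbitJ w g x : porbit (w ^ g) (g x) = g @: porbit w x.
Proof.
apply/setP => y; apply/porbitP/imsetP => [[i ->]|[_ /porbitP[i ->] ->]].
  by exists ((w ^+ i) x); rewrite ?mem_porbit // -conjXg conjgE !permM permK.
by exists i; rewrite -conjXg conjgE !permM permK.
Qed.

Lemma block_groupJ w g : g \in W n ->
  (block_group w :^ g)%g = block_group (w ^ g).
Proof.
move=> Wg; apply/setP => h; rewrite mem_conjg !block_groupE groupJr ?groupV //.
have E y : ((h ^ g^-1) y \in porbit w y) = (h (g y) \in porbit (w ^ g) (g y)).
  rewrite porbitJ conjgE invgK !permM -[h (g y) in RHS](permKV g).
  by rewrite mem_imset //; apply: perm_inj.
congr (_ && _); apply/forallP/forallP => wh x; last by rewrite E.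
by rewrite -[x](permKV g) -E.
Qed.

Lemma block_group_min w u :
  w \in block_group u -> block_group w \subset block_group u.
Proof.
rewrite block_groupE => /andP[_ /forallP uw].
apply/subsetP => g; rewrite !block_groupE => /andP[-> /forallP wg].
apply/forallP => x; have /porbitP[i ->] := wg x.
elim: i => [|i IHi]; first by rewrite perm1 porbit_id.
rewrite expgSr permM; have := uw ((w ^+ i) x).
by move: IHi; rewrite -!eq_porbit_mem => /eqP ->.
Qed.

End BlockClosed.

Section AbelianRankBound.
Local Open Scope group_scope.
Variables (n p : nat).
Hypothesis p_pr : prime p.
Implicit Types (L N : {group {perm signed n}}) (g w : {perm signed n}).
Implicit Types x y : signed n.

Lemma perm_orbit_norm L a x : a \in 'N(L) ->
  a @: orbit 'P L x = orbit 'P L (a x).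
Proof.
move=> nLa; apply/setP => y; apply/imsetP/orbit_permP.
  case=> _ /orbit_permP[l Ll <-] ->; exists (l ^ a); first by rewrite memJ_norm.
  by rewrite conjgE !permM permK.
case=> l Ll <-; exists ((l ^ a^-1) x).
  by apply/orbit_permP; exists (l ^ a^-1); rewrite ?memJ_norm ?groupV.
by rewrite conjgE invgK !permM permKV.
Qed.

(** N / L acts faithfully on the sets F i, so that the bound for faithful
    abelian actions applies to them. *)
Lemma abelian_rank_leq L N (I : finType) (F : I -> {set signed n}) j :
  L <| N -> abelian (N / L) -> #|N : L| = (p ^ j)%N ->
  (forall a i, a \in N -> a @: F i \in codom F) ->
  (forall a, a \in N -> (forall i, a @: F i = F i) <-> a \in L) ->
  (p * j <= #|I|)%N.
Proof.
move=> /andP[sLN nLN] abNL oNL actF kerF.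
have cS : 'C_N([set F i | i : I] | 'P^*) = L.
  apply/setP => a; apply/setIP/idP => [[Na /astabP fixa]|La].
    by apply/(kerF a Na) => i; apply: (fixa (F i)); apply: imset_f.
  have Na := subsetP sLN a La; split=> //.
  by apply/astabP => _ /imsetP[i _ ->]; apply: (proj2 (kerF a Na) La).
have leSI : (#|[set F i | i : I]| <= #|I|)%N by apply: leq_imset_card.
apply: leq_trans leSI; apply: (abelian_action_bound p_pr (N := N) (to := ('P^*)%act)).
- apply/subsetP => a Na; rewrite !inE /=; apply/subsetP => _ /imsetP[i _ ->].
  by rewrite inE; have /codomP[k aFk] := actF a i Na; apply/imsetP; exists k.
- apply: subset_trans (der1_min nLN abNL) _.
  by rewrite -{1}cS subsetIr.
by rewrite cS.
Qed.

(** For p = 2 the quotient N / L acts faithfully on the at most 2n orbits of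
    L. For odd p it acts faithfully on the at most n unions of an orbit with
    its opposite: if a fixes all of these, then its square fixes all the
    orbits and lies in L, and N / L has odd order. *)
Lemma abelian_rank_W L j : has_abelian_rank (W n) p (@block_closed n) j L ->
  (j <= if p == 2 then n else n %/ p)%N.
Proof.
case/andP=> clL /existsP[N /and4P[sNW nLN abNL /eqP oNL]].
have nL a : a \in N -> a \in 'N(L) by apply/subsetP/normal_norm.
have inW a : a \in N -> a \in W n by apply/subsetP.
have UE x y : y \in orbit 'P L x -> orbit 'P L y = orbit 'P L x.
  by move/orbit_eqP=> /= ->.
have fixU a x : a \in L -> a @: orbit 'P L x = orbit 'P L x.
  move=> La; rewrite perm_orbit_norm ?(subsetP (normG L)) //.
  by apply: UE; apply/orbit_permP; exists a.
case: eqP => [p2|/eqP p_odd].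
  have : (p * j <= #|{: signed n}|)%N.
    apply: (abelian_rank_leq nLN abNL oNL (F := orbit 'P L)) => [a x Na|a Na].
      by rewrite perm_orbit_norm ?nL // codom_f.
    split=> [fixa|La x]; last exact: fixU.
    apply: (block_closedP clL) => [|x]; first exact: inW.
    by rewrite -(fixa x) imset_f ?orbit_refl.
  by rewrite card_prod card_ord card_bool p2 mulnC leq_pmul2r.
rewrite leq_divRL ?prime_gt0 // mulnC -[X in (_ <= X)%N]card_ord.
pose V x := orbit 'P L x :|: orbit 'P L (sopp x).
have Vs x : V (sopp x) = V x by rewrite /V soppK setUC.
have VI x : V x = V (x.1, false).
  by case: x => i [] //; rewrite -[in RHS]Vs.
have actV a x : a \in N -> a @: V x = V (a x).
  by move=> Na; rewrite imsetU !perm_orbit_norm ?nL // W_sopp ?inW.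
apply: (abelian_rank_leq nLN abNL oNL (F := fun i : 'I_n => V (i, false))).
  by move=> a i Na; rewrite actV // VI; apply: (codom_f (fun i => V (i, false))).
move=> a Na; split=> [fixa|La i]; last first.
  by rewrite /V imsetU !fixU.
have Wa := inW a Na.
have aV x : a x \in V x.
  by rewrite VI -fixa -VI imset_f // inE orbit_refl.
have a2L : a ^+ 2 \in L.
  apply: (block_closedP clL) => [|x]; first by rewrite groupX.
  rewrite expgS expg1 permM.
  have step y z : a y \in orbit 'P L z -> a (a y) \in orbit 'P L (a z).
    by move=> ayz; rewrite -perm_orbit_norm ?nL ?imset_f.
  have /setUP[ax|asx] := aV x.
    by rewrite -(UE _ _ ax) step ?orbit_refl // UE.
  have [l Ll lsx] := orbit_permP _ _ _ asx.
  have Wl : l \in W n by apply: (subsetP (andP clL).1).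
  have : a (l x) \in orbit 'P L (a x).
    by rewrite -perm_orbit_norm ?nL // imset_f //; apply/orbit_permP; exists l.
  case/orbit_permP=> k Lk kax; apply/orbit_permP; exists (l * k).
    exact: groupM.
  have Wk : k \in W n by apply: (subsetP (andP clL).1).
  by rewrite permM -lsx W_sopp // (W_sopp _ Wa) -kax -lsx !W_sopp // soppK.
have : #[coset L a] %| gcdn 2 (p ^ j).
  rewrite dvdn_gcd order_dvdn -morphX ?nL //= coset_id // eqxx /=.
  rewrite -oNL -card_quotient ?normal_norm // order_dvdG // mem_quotient //.
rewrite (eqP (_ : coprime 2 (p ^ j))); last first.
  by rewrite coprimeXr // prime_coprime // dvdn_prime2 // eq_sym.
rewrite dvdn1 order_eq1 => /eqP; apply: coset_idr; exact: nL.
Qed.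

End AbelianRankBound.

(** * Cycles of a signed permutation *)

Section Cycles.
Local Open Scope group_scope.

Lemma permX_porbit_eq (T : finType) (w : {perm T}) x k l :
  ((w ^+ k) x == (w ^+ l) x) = (k == l %[mod #|porbit w x|]).
Proof.
set m := #|porbit w x|; have m_gt0 : (0 < m)%N by rewrite lt0n card_porbit_neq0.
have modE i : (w ^+ i) x = (w ^+ (i %% m)) x.
  rewrite {1}(divn_eq i m) expgD permM; congr (fun_of_perm _ _).
  rewrite mulnC expgM; elim: (i %/ m) => [|j IHj]; first by rewrite perm1.
  by rewrite expgSr permM IHj permX iter_porbit.
rewrite (modE k) (modE l) !permX.
rewrite -!(nth_traject w (n := m)) ?ltn_pmod // nth_uniq ?size_traject ?ltn_pmod //.
exact: uniq_traject_porbit.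
Qed.

Variable n : nat.
Implicit Types (g u w : {perm signed n}) (x y : signed n).

Lemma sopp_permX w i x : w \in W n -> (w ^+ i) (sopp x) = sopp ((w ^+ i) x).
Proof. by move=> Ww; rewrite W_sopp ?groupX. Qed.

Lemma mem_porbit_sopp w x y : w \in W n ->
  (sopp y \in porbit w (sopp x)) = (y \in porbit w x).
Proof.
move=> Ww; apply/porbitP/porbitP => -[i]; last by move->; exists i; rewrite sopp_permX.
by rewrite sopp_permX // => /(can_inj (@soppK n)) ->; exists i.
Qed.

(** The cycle of x is stable under sign change. The other cycles come in pairs
    of opposite cycles. *)
Definition negative w x := sopp x \in porbit w x.

Lemma negative_porbit w x y : w \in W n -> y \in porbit w x ->
  negative w y = negative w x.
Proof.
move=> Ww yx; rewrite /negative -eq_porbit_mem -[in RHS]eq_porbit_mem.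
have/eqP E : porbit w (sopp y) == porbit w (sopp x).
  by rewrite eq_porbit_mem mem_porbit_sopp.
by rewrite E; congr (_ == _); apply/eqP; rewrite eq_porbit_mem.
Qed.

Lemma negative_sopp w x : w \in W n -> negative w (sopp x) = negative w x.
Proof.
by move=> Ww; rewrite /negative soppK -{1}[x]soppK mem_porbit_sopp ?soppK //.
Qed.

(** A base point in each cycle, chosen once for each pair of opposite cycles. *)
Lemma porbit_base w : w \in W n -> exists b : signed n -> signed n,
  [/\ forall x, b x \in porbit w x,
      forall x y, y \in porbit w x -> b y = b x
    & forall x, ~~ negative w x -> b (sopp x) = sopp (b x)].
Proof.
move=> Ww; pose P x := porbit w x :|: porbit w (sopp x).
have Ps x : P (sopp x) = P x by rewrite /P soppK setUC.
have Py x y : y \in porbit w x -> P y = P x.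
  move=> yx; rewrite /P; congr (_ :|: _); apply/eqP.
    by rewrite eq_porbit_mem.
  by rewrite eq_porbit_mem mem_porbit_sopp.
pose r x := odflt x [pick y in P x].
have rP x : r x \in P x.
  by rewrite /r; case: pickP => //= /(_ x); rewrite inE porbit_id.
have rE x y : P x = P y -> r x = r y.
  rewrite /r => <-; case: pickP => //= /(_ x); by rewrite inE porbit_id.
exists (fun x => if r x \in porbit w x then r x else sopp (r x)); split=> [x|x y yx|x].
- case: ifPn => // nrx; have := rP x; rewrite inE (negPf nrx) /=.
  by rewrite -{1}(soppK (r x)) mem_porbit_sopp.
- rewrite (rE y x (Py x y yx)).
  suff -> : porbit w y = porbit w x by [].
  by apply/eqP; rewrite eq_porbit_mem.
move=> posx; rewrite (rE _ _ (Ps x)).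
have := rP x; rewrite inE; case: ifP => [rsx _|_ /orP[|] rx].
- suff /negPf -> : r x \notin porbit w x by rewrite soppK.
  apply: contra posx => rx; rewrite /negative porbit_sym -eq_porbit_mem.
  rewrite -eq_porbit_mem in rx; rewrite -eq_porbit_mem in rsx.
  by rewrite -(eqP rx) (eqP rsx).
- by rewrite rx.
by move: rx; case: ifP.
Qed.

(** Each point is given by the base point of its cycle and a number of steps. *)
Lemma porbit_coordinates w : w \in W n ->
  exists b : signed n -> signed n, exists i : signed n -> nat,
  [/\ forall x, b x \in porbit w x,
      forall x y, y \in porbit w x -> b y = b x,
      forall x, ~~ negative w x -> b (sopp x) = sopp (b x),
      forall x, (w ^+ i x) (b x) = x
    & forall x, (i x < #|porbit w x|)%N].
Proof.
move=> Ww; have [b [b_in b_const b_pos]] := porbit_base Ww.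
have xb x : x \in traject w (b x) #|porbit w (b x)|.
  by rewrite -porbit_traject porbit_sym.
exists b; exists (fun x => index x (traject w (b x) #|porbit w (b x)|)).
split=> // x; last first.
  suff <- : porbit w (b x) = porbit w x.
    by rewrite -[X in (_ < X)%N](size_traject w (b x)) index_mem.
  by apply/eqP; rewrite eq_porbit_mem.
rewrite permX -(nth_traject w (n := #|porbit w (b x)|)) ?nth_index //.
by rewrite -[X in (_ < X)%N](size_traject w (b x)) index_mem.
Qed.

Lemma card_porbit_sopp w x : w \in W n -> #|porbit w (sopp x)| = #|porbit w x|.
Proof.
move=> Ww; rewrite -[RHS](card_imset _ (can_inj (@soppK n))).
apply: eq_card => y; apply/idP/imsetP => [xy|[z xz ->]].
  by exists (sopp y); rewrite ?soppK // -mem_porbit_sopp // soppK.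
by rewrite mem_porbit_sopp.
Qed.

End Cycles.

Section Conjugacy.
Local Open Scope group_scope.
Variable n : nat.
Implicit Types (g u w : {perm signed n}) (x y : signed n).

(** Used for a negative cycle of length m: sign change acts on it as the
    rotation by k steps, an involution without fixed points, so it is the half
    turn. *)
Lemma modn_half m k : (0 < m)%N -> (k.*2 = 0 %[mod m])%N ->
  (k != 0 %[mod m])%N -> ((k %% m).*2 = m)%N.
Proof.
rewrite mod0n => m_gt0 /eqP k2 k0; move: k2; rewrite -muln2 -modnMml.
set r := (k %% m)%N in k0 *; have := ltn_pmod k m_gt0; rewrite -/r => ltrm.
case/dvdnP=> q rq; have q1 : q = 1%N by nia.
by rewrite -muln2 rq q1 mul1n.
Qed.

Lemma negative_half w x k : w \in W n -> sopp x = (w ^+ k) x ->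
  (k.*2 = 0 %[mod #|porbit w x|])%N /\ (k != 0 %[mod #|porbit w x|])%N.
Proof.
move=> Ww sxk; split.
  apply/eqP; rewrite -(permX_porbit_eq w) expg0 perm1 -addnn expgD permM -sxk.
  by rewrite sopp_permX // -sxk soppK.
by rewrite -(permX_porbit_eq w) expg0 perm1 -sxk sopp_neq.
Qed.

(** The map that keeps the base points and the numbers of steps, but replaces
    w by u, conjugates w to u. It commutes with sign change because this is
    the half turn for both u and w on each negative cycle. *)
Lemma same_porbits_conj u w : u \in W n -> w \in W n ->
  (forall x, porbit u x = porbit w x) -> exists2 g, g \in W n & u = w ^ g.
Proof.
move=> Wu Ww uw.
have [b [i [b_in b_const b_pos iP _]]] := porbit_coordinates Ww.
have bb x : b (b x) = b x by apply: b_const.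
(* Both equations mean that k and l agree modulo the length of the cycle. *)
have tr y k l : (w ^+ k) y = (w ^+ l) y -> (u ^+ k) y = (u ^+ l) y.
  by move/eqP; rewrite permX_porbit_eq -uw -permX_porbit_eq => /eqP.
pose f x := (u ^+ i x) (b x).
have fw x : f (w x) = u (f x).
  have bw : b (w x) = b x by apply: b_const; apply: (mem_porbit w 1).
  by rewrite /f bw -permM -expgSr; apply: tr; rewrite -{1}bw iP expgSr permM iP.
have fs x : f (sopp x) = sopp (f x).
  have [|pos] := boolP (negative w x); last first.
    rewrite /f b_pos // sopp_permX // -!sopp_permX //; apply: tr.
    by rewrite -{1}b_pos // iP sopp_permX // iP.
  move=> neg; have bs : b (sopp x) = b x by apply: b_const.
  have : negative w (b x) by rewrite (negative_porbit Ww (b_in x)).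
  move=> neb; have /porbitP[k sbk] := neb.
  have : sopp (b x) \in porbit u (b x) by rewrite uw.
  case/porbitP=> l sbl.
  have [k2 k0] := negative_half Ww sbk; have [l2 l0] := negative_half Wu sbl.
  rewrite uw in l2 l0.
  have kl : (w ^+ k) (b x) = (w ^+ l) (b x).
    apply/eqP; rewrite permX_porbit_eq; apply/eqP.
    move: k2 k0 l2 l0; set m := #|_|; have m_gt0 : (0 < m)%N.
      by rewrite lt0n card_porbit_neq0.
    by move=> k2 k0 l2 l0; have := modn_half m_gt0 k2 k0;
      rewrite -{2}(modn_half m_gt0 l2 l0) => /double_inj.
  have ub : (u ^+ k) (b x) = sopp (b x) by rewrite sbl; apply: tr.
  rewrite /f bs -sopp_permX // -ub -permM -expgD; apply: tr.
  by rewrite -{1}bs iP expgD permM -sbk sopp_permX // iP.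
have f_inj : injective f.
  move=> x y fxy; have bxy : b x = b y.
    rewrite -[b x]bb -[b y]bb; apply: b_const; rewrite -uw -eq_porbit_mem.
    rewrite -(porbit_perm u (i x)) -/(f x) fxy /f porbit_perm //.
  rewrite -(iP x) -(iP y) -bxy; apply/eqP.
  by rewrite permX_porbit_eq -uw -permX_porbit_eq {2}bxy; apply/eqP.
exists (perm f_inj); first by apply: W_mem => x; rewrite !permE.
apply/permP => x; rewrite conjgE !permM -[in LHS](permKV (perm f_inj) x).
by rewrite !permE -fw.
Qed.

End Conjugacy.

Section InjectiveSum.
Variable T : finType.
Implicit Types (A : {set T}) (f : T -> nat).

(** The point x where f is largest: the values of f on A are distinct and at
    most f x. *)
Lemma injective_max A f x0 : {in A &, injective f} -> x0 \in A ->
  exists x, [/\ x \in A, forall y, y \in A -> f y <= f x & #|A :\ x| <= f x].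
Proof.
move=> injf Ax0; have [x Ax maxx] := @arg_maxnP _ x0 (mem A) f Ax0.
exists x; split=> //.
have cA : #|A| = #|A :\ x|.+1 by rewrite (cardsD1 x A) [x \in A]Ax.
rewrite -ltnS -cA -(card_in_imset (f := fun y => inord (f y) : 'I_(f x).+1)).
  by rewrite (leq_trans (max_card _)) // card_ord.
move=> y z Ay Az /(congr1 val) /=; rewrite !inordK ?ltnS; [exact: injf | exact: maxx..].
Qed.

Lemma sum_injective_geq A f : {in A &, injective f} ->
  \sum_(j < #|A|) j <= \sum_(x in A) f x.
Proof.
have [m] := ubnP #|A|; elim: m => // m IHm in A * => leAm injf.
have [->|[x0 Ax0]] := set_0Vmem A; first by rewrite cards0 big_ord0.
have [x [Ax maxx fx_ge]] := injective_max injf Ax0.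
have cA : #|A| = #|A :\ x|.+1 by rewrite (cardsD1 x A) Ax.
rewrite cA big_ord_recr /= (big_setD1 x) //= addnC leq_add // IHm //.
  by rewrite -ltnS -cA.
by move=> y z /setD1P[_ Ay] /setD1P[_ Az]; apply: injf.
Qed.

(** Remove the point of largest value, which is at least #|A| - 1, and argue by
    induction on A. *)
Lemma sum_injective_eq A f : {in A &, injective f} ->
  (\sum_(x in A) f x = \sum_(j < #|A|) j) <-> (forall x, x \in A -> f x < #|A|).
Proof.
have [m] := ubnP #|A|; elim: m => // m IHm in A * => leAm injf.
have [->|[x0 Ax0]] := set_0Vmem A.
  by rewrite cards0 big_ord0 big_set0; split=> // _ x; rewrite inE.
have [x [Ax maxx fx_ge]] := injective_max injf Ax0.
have cA : #|A| = #|A :\ x|.+1 by rewrite (cardsD1 x A) Ax.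
have injf' : {in A :\ x &, injective f}.
  by move=> y z /setD1P[_ Ay] /setD1P[_ Az]; apply: injf.
have sumA := sum_injective_geq injf'.
rewrite cA big_ord_recr /= (big_setD1 x) //=; split=> [eqA y Ay|ltA].
  rewrite ltnS (leq_trans (maxx y Ay)) //.
  by rewrite -(leq_add2r (\sum_(z in A :\ x) f z)) eqA addnC leq_add2l.
have fxE : f x = #|A :\ x| by apply/eqP; rewrite eqn_leq fx_ge -ltnS ltA.
rewrite addnC fxE; congr addn; apply/(IHm _ _ injf') => [|y /setD1P[neyx Ay]].
  by rewrite -ltnS -cA.
rewrite -fxE ltn_neqAle maxx // andbT; apply: contraNneq neyx => /injf.
by move=> ->.
Qed.

End InjectiveSum.

(** * Rankings of the cycles *)

Section Ranking.
Local Open Scope group_scope.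
Variable n : nat.
Implicit Types (g u w : {perm signed n}) (x y : signed n) (r : signed n -> nat).

(** The ranks below n are meant for the positive cycles, and the ranks from n
    on for the negative ones. The condition says that a cycle of u meets each
    level of r in at most one pair of opposite points, and that the negative
    cycles avoid the low levels. *)
Definition level_transversal u r :=
  [/\ forall x, r (sopp x) = r x,
      forall x y, y \in porbit u x -> r y = r x -> y = x \/ y = sopp x
    & forall x, negative u x -> (n <= r x)%N].

(** By counting, a positive cycle of length m has the ranks 0, ..., m - 1, and
    a negative cycle of length 2m the ranks n, ..., n + m - 1, each of them at
    two opposite points. *)
Definition ranking u r := level_transversal u r /\
  forall x, (if negative u x then (r x - n).*2 else r x) < #|porbit u x|.

(** On a negative cycle the sign bit tells apart the two opposite points of
    the same rank, which makes the code injective on every cycle. *)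
Definition rank_code u r x :=
  if negative u x then ((r x - n).*2 + x.2)%N else r x.

Lemma rank_code_inj u r x : u \in W n -> level_transversal u r ->
  {in porbit u x &, injective (rank_code u r)}.
Proof.
move=> Wu [_ r_inj r_neg] y z xy xz; rewrite /rank_code.
have yz : y \in porbit u z.
  by move: xy xz; rewrite -!eq_porbit_mem => /eqP -> /eqP ->.
rewrite !(negative_porbit Wu (_ : _ \in porbit u x)) //.
case: ifP => neg eqc.
  have [ny nz] : (n <= r y)%N /\ (n <= r z)%N.
    by split; apply: r_neg; rewrite (negative_porbit Wu (_ : _ \in porbit u x)).
  have [] := r_inj z y yz; [by case: (y.2) (z.2) eqc => [] [] /=; lia | by [] | ].
  move=> yE; move: eqc; rewrite yE /=; case: (z.2) => /=; lia.
have [//||yE] := r_inj z y yz; first by [].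
by move: neg; rewrite -(negative_porbit Wu xz) /negative -yE yz.
Qed.

(** Sign change exchanges the points of the cycle with sign bit 0 and those
    with sign bit 1. *)
Lemma negative_card_even u x : u \in W n -> negative u x -> ~~ odd #|porbit u x|.
Proof.
move=> Wu neg; have cs : #|[set y in porbit u x | y.2]| =
    #|porbit u x :\: [set y : signed n | y.2]|.
  rewrite -(card_imset _ (can_inj (@soppK n))); apply: eq_card => y.
  apply/imsetP/idP => [[z]|].
    rewrite !inE => /andP[xz z2] ->; rewrite /= z2 /=.
    have := negative_porbit Wu xz; rewrite neg => negz.
    by move: xz negz; rewrite /negative -!eq_porbit_mem => /eqP ->.
  rewrite !inE => /andP[y2 xy]; exists (sopp y); last by rewrite soppK.
  rewrite inE /= y2 andbT.
  have := negative_porbit Wu xy; rewrite neg => negz.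
  by move: xy negz; rewrite /negative -!eq_porbit_mem => /eqP ->.
rewrite -(cardsID [set y : signed n | y.2] (porbit u x)) -cs.
have -> : porbit u x :&: [set y : signed n | y.2] = [set y in porbit u x | y.2].
  by apply/setP => y; rewrite !inE.
by rewrite addnn odd_double.
Qed.

Lemma ranking_codeP u r : u \in W n -> level_transversal u r ->
  ranking u r <-> (forall x, rank_code u r x < #|porbit u x|).
Proof.
move=> Wu tr; rewrite /rank_code; split=> [[_ lt] x|lt].
  have := lt x; case: ifP => // neg ltx.
  have := negative_card_even Wu neg; move: ltx; case: (x.2) => /=; lia.
split=> // x; have := lt x; case: ifP => // _; apply: leq_ltn_trans.
exact: leq_addr.
Qed.

Lemma sum_porbits u (f : signed n -> nat) :
  \sum_x f x = \sum_(B in porbits u) \sum_(x in B) f x.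
Proof.
rewrite (partition_big_imset (porbit u)) /=; apply: eq_bigr => B /imsetP[x _ ->].
by apply: eq_bigl => y; rewrite eq_porbit_mem.
Qed.

(** On every cycle the codes of r are distinct, hence their sum is least when
    they fill an initial segment, as those of a ranking do. *)
Lemma transversal_sum u r r0 : u \in W n -> level_transversal u r -> ranking u r0 ->
  \sum_x r0 x <= \sum_x r x
  /\ (\sum_x r0 x = \sum_x r x -> ranking u r).
Proof.
move=> Wu tr rk0; have [tr0 _] := rk0.
have blk B : B \in porbits u -> \sum_(x in B) r0 x <= \sum_(x in B) r x
  /\ (\sum_(x in B) r0 x = \sum_(x in B) r x ->
      forall x, x \in B -> rank_code u r x < #|B|).
  case/imsetP=> x _ ->; have inj := rank_code_inj Wu tr (x := x).
  have inj0 := rank_code_inj Wu tr0 (x := x).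
  have c0 y : y \in porbit u x -> rank_code u r0 y < #|porbit u x|.
    by rewrite -eq_porbit_mem => /eqP <-; apply: (proj1 (ranking_codeP Wu tr0)).
  have := sum_injective_geq inj; rewrite -(proj2 (sum_injective_eq inj0) c0).
  have := proj1 (sum_injective_eq inj); rewrite -(proj2 (sum_injective_eq inj0) c0).
  have [neg|pos] := boolP (negative u x); last first.
    have E r1 : \sum_(y in porbit u x) rank_code u r1 y = \sum_(y in porbit u x) r1 y.
      apply: eq_bigr => y xy.
      by rewrite /rank_code (negative_porbit Wu xy) (negPf pos).
    by rewrite !E => eqs les; split=> // /esym/eqs.
  have E r1 : level_transversal u r1 ->
      ((\sum_(y in porbit u x) r1 y).*2 + \sum_(y in porbit u x) y.2)%N =
      (\sum_(y in porbit u x) rank_code u r1 y + \sum_(y in porbit u x) n.*2)%N.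
    case=> _ _ r_neg; rewrite -mul2n big_distrr -!big_split; apply: eq_bigr => y xy /=.
    have negy : negative u y by rewrite (negative_porbit Wu xy).
    rewrite /rank_code negy; have := r_neg y negy; move: (nat_of_bool y.2) (r1 y); lia.
  move: (E r tr) (E r0 tr0); set s := \sum_(y in _) nat_of_bool (y : signed n).2.
  set t := \sum_(y in _) n.*2.
  set a := \sum_(y in _) rank_code u r y; set a0 := \sum_(y in _) rank_code u r0 y.
  set b := \sum_(y in _) r y; set b0 := \sum_(y in _) r0 y.
  move=> Ea Ea0 eqs les; split; first by lia.
  by move=> eqb; apply: eqs; lia.
rewrite !(sum_porbits u).
have leif := leqif_sum (fun B uB => leqif_eq (proj1 (blk B uB))).
split; first exact: leif.1.
move/eqP; rewrite leif.2 => /forall_inP eqB; apply/ranking_codeP => // x.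
have ux : porbit u x \in porbits u by apply: imset_f.
by apply: (proj2 (blk _ ux) (eqP (eqB _ ux))); apply: porbit_id.
Qed.

End Ranking.

Section RankingConstructions.
Local Open Scope group_scope.
Variable n : nat.
Implicit Types (g u w : {perm signed n}) (x y : signed n) (r : signed n -> nat).

Lemma modn_double_shift h a c : (a < h.*2)%N -> (c < h.*2)%N -> a != c ->
  (a = c %[mod h])%N -> (a = h + c %[mod h.*2])%N.
Proof.
wlog lt_ca : a c / (c < a)%N => [IH lta ltc neq eqm|lta ltc neq /eqP].
  have [ltac|ltca|eqac] := ltngtP a c; last by rewrite eqac eqxx in neq.
    have E : (c = h + a %[mod h.*2])%N by apply: IH; rewrite // eq_sym.
    by rewrite -modnDmr E modnDmr addnA addnn modnDl.
  exact: IH.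
rewrite eqn_mod_dvd ?(ltnW lt_ca) // => /dvdnP[q eq_q].
have q1 : q = 1%N by nia.
by congr (_ %% _)%N; lia.
Qed.

(** The rank is the number of steps from the base point; on a negative cycle
    it is taken modulo half the length, because sign change is the half turn,
    and shifted by n. *)
Lemma ranking_exists w : w \in W n -> exists r, ranking w r.
Proof.
move=> Ww; have [b [i [b_in b_const b_pos iP i_lt]]] := porbit_coordinates Ww.
pose m x := #|porbit w x|.
have m_gt0 x : (0 < m x)%N by rewrite lt0n card_porbit_neq0.
have mb x : m (b x) = m x.
  by rewrite /m; congr #|pred_of_set _|; apply/eqP; rewrite eq_porbit_mem.
exists (fun x => if negative w x then n + i x %% (m x)./2 else i x)%N.
have half x : negative w x -> exists k, exists h,
    [/\ sopp (b x) = (w ^+ k) (b x), m x = h.*2, k %% h.*2 = h & 0 < h]%N.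
  move=> neg; have : negative w (b x) by rewrite (negative_porbit Ww (b_in x)).
  case/porbitP=> k sbk; exists k; exists (k %% m x)%N.
  have [k2 k0] := negative_half Ww sbk; rewrite -/(m (b x)) mb in k2 k0.
  split; rewrite ?(modn_half (m_gt0 x) k2 k0) //.
  by rewrite mod0n -lt0n in k0.
split; first split.
- move=> x; rewrite negative_sopp //; case: ifP => [neg|/negbT pos].
    rewrite /m card_porbit_sopp // -/(m x); congr (n + _)%N.
    have [k [h [sbk mk kh h_gt0]]] := half x neg.
    have bs : b (sopp x) = b x by apply: b_const.
    have : (i (sopp x) == i x + k %[mod m x])%N.
      rewrite -(mb x) -(permX_porbit_eq w) -{1}bs iP addnC expgD permM -sbk.
      by rewrite sopp_permX // iP.
    rewrite mk doubleK => /eqP eqi; have hm : (h %| h.*2)%N by rewrite -mul2n dvdn_mull.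
    rewrite -(modn_dvdm (i (sopp x)) hm) eqi modn_dvdm // -modnDmr.
    by rewrite -(modn_dvdm k hm) kh modnn addn0.
  have : (i (sopp x) == i x %[mod m (sopp (b x))])%N.
    by rewrite -(permX_porbit_eq w) -{1}b_pos // iP sopp_permX // iP.
  rewrite /m card_porbit_sopp // -/(m (b x)) mb.
  have lt_is : (i (sopp x) < m x)%N by rewrite /m -(card_porbit_sopp x Ww) i_lt.
  by rewrite !modn_small ?i_lt // => /eqP.
- move=> x y xy; have bxy := b_const _ _ xy.
  have mxy : m y = m x by rewrite -mb bxy mb.
  rewrite (negative_porbit Ww xy) mxy; case: ifP => [neg /addnI eqi|_ eqi].
    have [k [h [sbk mk kh h_gt0]]] := half x neg.
    have [i1 i2] := (i_lt x, i_lt y); rewrite -/(m x) -/(m y) mxy mk in i1 i2.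
    have [eq_i|neq_i] := eqVneq (i y) (i x).
      by left; rewrite -(iP y) -(iP x) bxy eq_i.
    right; rewrite -(iP y) -[in RHS](iP x) bxy -sopp_permX // sbk -permM -expgD.
    apply/eqP; rewrite permX_porbit_eq -/(m (b x)) mb mk -modnDml kh; apply/eqP.
    by apply: modn_double_shift; rewrite // mk doubleK in eqi *.
  by left; rewrite -(iP y) -(iP x) bxy eqi.
- by move=> x ->; rewrite leq_addr.
move=> x /=; case: (boolP (negative w x)) => neg; last exact: i_lt.
have [k [h [sbk mk kh h_gt0]]] := half x neg.
by rewrite addKn -/(m x) mk doubleK ltn_double ltn_pmod.
Qed.

End RankingConstructions.

Lemma injective_onto (T : finType) (A : {set T}) (f : T -> nat) k :
  {in A &, injective f} -> (forall x, x \in A -> f x < #|A|) -> k < #|A| ->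
  exists2 x, x \in A & f x = k.
Proof.
move=> injf ltf ltk; pose F x : 'I_#|A| := insubd (Ordinal ltk) (f x).
have FE x : x \in A -> val (F x) = f x by move=> Ax; rewrite val_insubd ltf.
have cF : #|F @: A| = #|A|.
  by apply: card_in_imset => x y Ax Ay /(congr1 val); rewrite !FE //; apply: injf.
have : Ordinal ltk \in F @: A.
  have /eqP -> : F @: A == setT by rewrite eqEcard subsetT cardsT card_ord cF leqnn.
  by rewrite inE.
by case/imsetP=> x Ax /(congr1 val) /=; rewrite FE // => ->; exists x.
Qed.

Lemma perm_eq_reindex (T : finType) (E : eqType) (f g : T -> E) :
  (forall v, #|[set x | f x == v]| = #|[set x | g x == v]|) ->
  exists2 h : T -> T, injective h & forall x, g (h x) = f x.
Proof.
move=> eqfg; have : perm_eq (codom_tuple f) (codom_tuple g).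
  have cnt (k : T -> E) v : count_mem v (codom k) = #|[set x | k x == v]|.
    rewrite /codom /image_mem count_map -size_filter cardsE cardE /enum_mem.
    by rewrite -filter_predI; congr size; apply: eq_filter => x /=; rewrite andbT.
  by apply/allP => v _; rewrite /= !cnt eqfg.
case/tuple_permP=> p fp; exists (fun x => enum_val (p (enum_rank x))).
  by move=> x y /enum_val_inj/perm_inj/enum_rank_inj.
move=> x; have := congr1 (fun s => nth (f x) s (enum_rank x)) fp.
rewrite nth_codom enum_rankK => ->; rewrite -tnth_nth tnth_mktuple.
by rewrite (tnth_nth (f x)) nth_codom.
Qed.

Section RankLift.
Local Open Scope group_scope.
Variable n : nat.
Implicit Types (g u w : {perm signed n}) (x y : signed n) (r : signed n -> nat).

Lemma card_positive_porbit w x : w \in W n -> ~~ negative w x ->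
  #|porbit w x| <= n.
Proof.
move=> Ww pos; rewrite -leq_double -addnn -{2}(card_porbit_sopp x Ww).
have : porbit w x :&: porbit w (sopp x) = set0.
  apply/setP => y; rewrite !inE; apply: contraNF pos => /andP[].
  by rewrite /negative -!eq_porbit_mem => /eqP -> /eqP ->.
have := cardsUI (porbit w x) (porbit w (sopp x)) => cU c0.
rewrite c0 cards0 addn0 in cU; rewrite -cU (leq_trans (max_card _)) //.
by rewrite card_prod card_ord card_bool muln2.
Qed.

Lemma ranking_negative w r x : w \in W n -> ranking w r ->
  negative w x = (n <= r x)%N.
Proof.
move=> Ww [[_ _ r_neg] r_lt]; have := r_lt x.
case: ifP => [neg _|/negbT pos lt]; first by rewrite r_neg.
by apply/esym/negbTE; rewrite -ltnNge (leq_trans lt) // card_positive_porbit.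
Qed.

Lemma rank_codeP w r x k : w \in W n -> ranking w r -> k < #|porbit w x| ->
  exists2 y, y \in porbit w x & rank_code w r y = k.
Proof.
move=> Ww rk ltk; have [tr _] := rk; apply: injective_onto => //.
  exact: rank_code_inj.
move=> y; rewrite -eq_porbit_mem => /eqP <-.
exact: (proj1 (ranking_codeP Ww tr)).
Qed.

Lemma rank_code_transfer u w r1 r2 x y :
  u \in W n -> w \in W n -> ranking w r1 -> ranking u r2 ->
  negative u y = negative w x -> rank_code u r2 y = rank_code w r1 x ->
  r2 y = r1 x /\ rank_code u r2 (sopp y) = rank_code w r1 (sopp x).
Proof.
move=> Wu Ww [[rs1 _ rn1] _] [[rs2 _ rn2] _] ny.
rewrite /rank_code !negative_sopp // ny rs1 rs2; case: ifP => // neg /= eqc.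
have n1 := rn1 x neg; have n2 : (n <= r2 y)%N by rewrite rn2 // ny.
by move: eqc; case: (x.2); case: (y.2) => /=; lia.
Qed.

(** Given an equivariant correspondence b between the cycles of w and those of
    u that preserves lengths, the points of corresponding cycles are matched
    by their codes. The result commutes with sign change and sends one ranking
    to the other. *)
Lemma rank_lift u w r1 r2 (b : signed n -> signed n) :
  u \in W n -> w \in W n -> ranking w r1 -> ranking u r2 ->
  (forall x, b (sopp x) = sopp (b x)) ->
  (forall x y, (b y \in porbit u (b x)) = (y \in porbit w x)) ->
  (forall x, #|porbit u (b x)| = #|porbit w x|) ->
  exists2 h, h \in W n &
    forall x, r2 (h x) = r1 x /\ h x \in porbit u (b x).
Proof.
move=> Wu Ww rk1 rk2 bs bu cb; have [[tr1 _] [tr2 _]] := (rk1, rk2).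
have ex x : {y | (y \in porbit u (b x)) && (rank_code u r2 y == rank_code w r1 x)}.
  apply: sigW.
  have [|y by1 cy] := @rank_codeP u r2 (b x) (rank_code w r1 x) Wu rk2.
    by rewrite cb; apply: (proj1 (ranking_codeP Ww tr1)).
  by exists y; rewrite by1 cy eqxx.
pose f x := sval (ex x).
have fP x : f x \in porbit u (b x) /\ rank_code u r2 (f x) = rank_code w r1 x.
  by rewrite /f; case: (ex x) => y /= /andP[-> /eqP ->].
have bneg x : negative u (f x) = negative w x.
  by rewrite (negative_porbit Wu (proj1 (fP x))) /negative -bs bu.
have ft x := rank_code_transfer Wu Ww rk1 rk2 (bneg x) (proj2 (fP x)).
have fs x : f (sopp x) = sopp (f x).
  apply: (rank_code_inj Wu tr2 (x := b (sopp x))); first exact: (proj1 (fP _)).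
    by rewrite bs mem_porbit_sopp //; apply: (proj1 (fP _)).
  by rewrite (proj2 (fP _)) (proj2 (ft x)).
have f_inj : injective f.
  move=> x y fxy; have xy : y \in porbit w x.
    rewrite -bu -eq_porbit_mem; have := proj1 (fP x); have := proj1 (fP y).
    by rewrite fxy -!eq_porbit_mem => /eqP <- /eqP <-.
  apply: (rank_code_inj Ww tr1 (x := x)); rewrite ?porbit_id //.
  by rewrite -!(proj2 (fP _)) fxy.
exists (perm f_inj); first by apply: W_mem => x; rewrite !permE.
by move=> x; rewrite permE; split; [apply: (proj1 (ft x)) | apply: (proj1 (fP x))].
Qed.

End RankLift.

Section RankingConjugacy.
Local Open Scope group_scope.
Variable n : nat.
Implicit Types (g u w : {perm signed n}) (x y d : signed n) (r : signed n -> nat).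

(** The point of least rank in the cycle of x. On a negative cycle there are
    two opposite ones, and the sign bit of x decides, so that b commutes with
    sign change. *)
Lemma rank_base w r : w \in W n -> ranking w r ->
  exists b : signed n -> signed n,
  [/\ forall x, b x \in porbit w x,
      forall x, r (b x) = (if negative w x then n else 0)%N,
      forall x, negative w x -> (b x).2 = x.2,
      forall x, b (sopp x) = sopp (b x)
    & forall x d, d \in porbit w x -> r d = (if negative w x then n else 0)%N ->
        (negative w x -> d.2 = x.2) -> b x = d].
Proof.
move=> Ww rk; have [tr lt] := rk; have [rs r_inj rn] := tr.
pose c0 x : nat := if negative w x then x.2 else false.
have c0_lt x : c0 x < #|porbit w x|.
  rewrite /c0; case: ifP => neg; last by rewrite lt0n card_porbit_neq0.
  have := negative_card_even Ww neg; have := card_porbit_neq0 w x.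
  by case: (x.2) => /=; lia.
have code_base x d : d \in porbit w x ->
    rank_code w r d = c0 x <-> r d = (if negative w x then n else 0)%N /\
      (negative w x -> d.2 = x.2).
  move=> xd; have neg := negative_porbit Ww xd.
  rewrite /rank_code /c0 neg; case: ifP => // nx; last by split=> [->|[]].
  have nd : (n <= r d)%N by rewrite rn // neg.
  split=> [eqc|[-> d2]]; last by rewrite subnn d2.
  by split; move: eqc; case: (x.2); case: (d.2) => /=; lia.
have ex x : {d | (d \in porbit w x) && (rank_code w r d == c0 x)}.
  apply: sigW; have [d xd cd] := rank_codeP Ww rk (c0_lt x).
  by exists d; rewrite xd cd eqxx.
pose b x := sval (ex x).
have bP x : b x \in porbit w x /\ rank_code w r (b x) = c0 x.
  by rewrite /b; case: (ex x) => d /= /andP[-> /eqP ->].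
have bB x := proj1 (code_base x (b x) (proj1 (bP x))) (proj2 (bP x)).
have b_uniq x d : d \in porbit w x -> r d = (if negative w x then n else 0)%N ->
    (negative w x -> d.2 = x.2) -> b x = d.
  move=> xd rd d2; apply: (rank_code_inj Ww tr (x := x)) => //.
    exact: (proj1 (bP x)).
  by rewrite (proj2 (bP x)); apply/esym/code_base.
exists b; split=> // x.
- exact: (proj1 (bP x)).
- exact: (proj1 (bB x)).
- exact: (proj2 (bB x)).
apply: b_uniq.
- by rewrite mem_porbit_sopp //; apply: (proj1 (bP x)).
- by rewrite rs negative_sopp //; apply: (proj1 (bB x)).
by rewrite negative_sopp // => neg /=; rewrite (proj2 (bB x)).
Qed.

Definition base_rank (s : bool) : nat := if s then n else 0.

(** Sending a point to the base of its cycle identifies the points of a given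
    rank with the bases of the cycles that are long enough to reach this rank;
    so the number of the latter depends only on r. On a negative cycle, which
    has even length, t < #|porbit w d| is the same as t./2 < #|porbit w d| /
    2. *)
Lemma card_bases w r s t : w \in W n -> ranking w r ->
  #|[set d | [&& (n <= r d)%N == s, r d == base_rank s & t < #|porbit w d| ]]| =
  #|[set x | ((n <= r x)%N == s) && (r x == if s then (n + t./2)%N else t)]|.
Proof.
move=> Ww rk; have [b [b_in rb b2 bs b_uniq]] := rank_base Ww rk.
have [tr lt] := rk; have [rs r_inj rn] := tr.
have negE x : negative w x = (n <= r x)%N by apply: ranking_negative.
have bneg x : (n <= r (b x))%N = (n <= r x)%N.
  by rewrite -!negE (negative_porbit Ww (b_in x)).
have bcard x : #|porbit w (b x)| = #|porbit w x|.
  by congr #|pred_of_set _|; apply/eqP; rewrite eq_porbit_mem.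
rewrite -[RHS](card_in_imset (f := b)); last first.
  move=> x y; rewrite !inE => /andP[/eqP nx /eqP rx] /andP[/eqP ny /eqP ry] bxy.
  have xy : y \in porbit w x.
    have := b_in x; have := b_in y; rewrite bxy -!eq_porbit_mem => /eqP <-.
    by rewrite eq_sym.
  have eqr : r y = r x by rewrite rx ry.
  have [->//|yE] := r_inj x y xy eqr.
  have neg : negative w x by rewrite /negative -yE.
  have := b2 x neg; rewrite bxy b2 yE ?negative_sopp //=; by case: (x.2).
apply: eq_card => d; apply/idP/imsetP => [|[x]]; rewrite !inE.
  case/and3P=> /eqP nd /eqP rd ltd.
  pose k := (if s then t./2.*2 + d.2 else t)%N.
  have ltk : k < #|porbit w d|.
    rewrite /k; case: s nd {rd k} => // nd.
    have := negative_card_even Ww (_ : negative w d); rewrite negE => /(_ nd).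
    by move: ltd; case: (d.2) => /=; lia.
  have [x dx cx] := rank_codeP Ww rk ltk.
  have nx : (n <= r x)%N = s by rewrite -negE (negative_porbit Ww dx) negE.
  move: cx; rewrite /rank_code negE nx /k => cx.
  exists x.
    rewrite inE nx eqxx /=; apply/eqP; case: s {k ltk} nd rd nx cx => // _ _ nx.
    by case: (x.2); case: (d.2) => /=; lia.
  apply/esym/b_uniq; rewrite ?negE ?nx //; first by rewrite porbit_sym.
  case: s {k ltk} nd rd nx cx => // _ _ nx.
  by case: (x.2); case: (d.2) => //=; lia.
case/andP=> /eqP nx /eqP rx ->; rewrite bneg nx eqxx rb negE nx eqxx /= bcard.
have := lt x; rewrite negE nx rx; case: s nx {rx} => // nx.
have := negative_card_even Ww (_ : negative w x); rewrite negE => /(_ nx).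
by rewrite addKn; lia.
Qed.

(** The condition does not change under sign change, which exchanges the sign
    bits. *)
Lemma card_half_bases w r (P : nat -> nat -> bool) : w \in W n -> ranking w r ->
  #|[set d : signed n | ~~ d.2 && P (r d) #|porbit w d|]|.*2 =
  #|[set d : signed n | P (r d) #|porbit w d|]|.
Proof.
move=> Ww [[rs _ _] _].
rewrite -(cardsID [set d : signed n | d.2] [set d | P (r d) #|porbit w d|]) -addnn.
congr (_ + _)%N; last by apply: eq_card => d; rewrite !inE.
rewrite -[RHS](card_imset _ (can_inj (@soppK n))); apply: eq_card => d.
apply/idP/imsetP => [|[e]]; rewrite !inE.
  case/andP=> d2 Pd; exists (sopp d); rewrite ?soppK // !inE /= d2 andbT.
  by rewrite rs card_porbit_sopp.
by case/andP=> Pe e2 ->; rewrite /= e2 rs card_porbit_sopp.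
Qed.

Lemma card_bases_eq u w r s k : u \in W n -> w \in W n ->
  ranking u r -> ranking w r -> (0 < k)%N ->
  #|[set d | [&& ~~ d.2, (n <= r d)%N == s, r d == base_rank s & #|porbit u d| == k]]| =
  #|[set d | [&& ~~ d.2, (n <= r d)%N == s, r d == base_rank s & #|porbit w d| == k]]|.
Proof.
move=> Wu Ww rku rkw k_gt0; apply: double_inj.
pose P a m := [&& (n <= a)%N == s, a == base_rank s & m == k].
rewrite -/(P _ _) (card_half_bases P Wu rku) (card_half_bases P Ww rkw) /P.
have E v : v \in W n -> ranking v r ->
    (#|[set d | [&& (n <= r d)%N == s, r d == base_rank s & #|porbit v d| == k]]| +
    #|[set x | ((n <= r x)%N == s) && (r x == if s then (n + k./2)%N else k)]| =
    #|[set x | ((n <= r x)%N == s) && (r x == if s then (n + k.-1./2)%N else k.-1)]|)%N.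
  move=> Wv rkv; rewrite -!(card_bases _ _ Wv rkv).
  set A := [set d | _]; set B := [set d | _ && (_ && (k < _))]; set C := [set d | _].
  have -> : C = A :|: B.
    apply/setP => d; rewrite !inE -!andb_orr; congr (_ && (_ && _)).
    by rewrite prednK // leq_eqVlt eq_sym.
  rewrite cardsU (_ : A :&: B = set0) ?cards0 ?subn0 //.
  apply/setP => d; rewrite !inE; apply/negP => /andP[/and3P[_ _ /eqP ->] /and3P[_ _]].
  by rewrite ltnn.
by have := E u Wu rku; rewrite -(E w Ww rkw) => /addIn.
Qed.

(** By card_bases the function r determines how many cycles there are of each
    length and sign. The bases of the cycles of w can thus be matched with
    those of the cycles of u, compatibly with sign change; rank_lift extends
    the matching to an element h of W n such that w ^ h has the same orbits as
    u. *)
Lemma ranking_conj u w r : u \in W n -> w \in W n -> ranking u r -> ranking w r ->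
  exists2 g, g \in W n & u = w ^ g.
Proof.
move=> Wu Ww rku rkw.
have [b [b_in rb b2 bs b_uniq]] := rank_base Ww rkw.
have [[rs rw_inj rwn] ltw] := rkw; have [[_ ru_inj run] ltu] := rku.
have negw x : negative w x = (n <= r x)%N by apply: ranking_negative.
have negu x : negative u x = (n <= r x)%N by apply: ranking_negative.
pose isb d := r d == base_rank (n <= r d)%N.
(* One base of each pair of opposite bases is labelled by the length of its
   cycle; its rank gives the sign of the cycle. *)
pose f v d := (r d, if ~~ d.2 && isb d then #|porbit v d| else 0%N).
have [v|p p_inj pE] := @perm_eq_reindex _ _ (f w) (f u).
  case: v => c [|k].
    apply: eq_card => d; rewrite !inE /f !xpair_eqE; congr (_ && _).
    by case: ifP; rewrite // !(negPf (card_porbit_neq0 _ _)).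
  have [cE|/negPf ncE] := eqVneq c (base_rank (n <= c)%N); last first.
    apply: eq_card => d; rewrite !inE /f !xpair_eqE.
    by have [rd|//] := eqVneq (r d) c; rewrite /isb rd ncE andbF.
  have E v : [set d | f v d == (c, k.+1)] = [set d | [&& ~~ d.2,
      (n <= r d)%N == (n <= c)%N, r d == base_rank (n <= c)%N & #|porbit v d| == k.+1]].
    apply/setP => d; rewrite !inE /f xpair_eqE -cE /isb.
    have [->|nrd] := eqVneq (r d) c; last by rewrite !andbF.
    by rewrite eqxx -cE eqxx andbT; case: (d.2).
  by rewrite !E (card_bases_eq _ Ww Wu).
have pP d : isb d -> ~~ d.2 -> [/\ r (p d) = r d, isb (p d), ~~ (p d).2 &
    #|porbit u (p d)| = #|porbit w d|].
  move=> bd d2; have := pE d; rewrite /f bd d2 /= => -[rp].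
  case: ifP => [/andP[p2 bp] cp|_ /esym/eqP]; first by split.
  by rewrite (negPf (card_porbit_neq0 _ _)).
pose q d := if d.2 then sopp (p (sopp d)) else p d.
have qs d : q (sopp d) = sopp (q d).
  by rewrite /q soppK /=; case: (d.2) => //=; rewrite soppK.
have isbs d : isb (sopp d) = isb d by rewrite /isb rs.
have qP d : isb d -> [/\ r (q d) = r d, isb (q d), (q d).2 = d.2 &
    #|porbit u (q d)| = #|porbit w d|].
  rewrite /q => bd; case d2: (d.2); last first.
    by have [-> -> /negPf -> ->] := pP d bd (negbT d2).
  have bsd : isb (sopp d) by rewrite isbs.
  have sd2 : ~~ (sopp d).2 by rewrite /= d2.
  have [rp bp p2 cp] := pP (sopp d) bsd sd2.
  by split; rewrite ?isbs ?rs ?rp ?rs ?card_porbit_sopp ?cp ?card_porbit_sopp.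
have q_inj d e : isb d -> isb e -> q d = q e -> d = e.
  move=> bd be qde; have [_ _ qd2 _] := qP d bd; have [_ _ qe2 _] := qP e be.
  have : d.2 = e.2 by rewrite -qd2 qde qe2.
  move: qde; rewrite /q => + de2; rewrite -de2; case: (d.2) => [|/p_inj //].
  by move/(can_inj (@soppK n))/p_inj/(can_inj (@soppK n)).
have isbb x : isb (b x).
  by rewrite /isb rb negw; case: leqP => //= lt; rewrite ?leqnn //; case: (n) lt.
pose c x := q (b x).
have cs x : c (sopp x) = sopp (c x) by rewrite /c bs qs.
have cc x : #|porbit u (c x)| = #|porbit w x|.
  have [_ _ _ ->] := qP _ (isbb x).
  by congr #|pred_of_set _|; apply/eqP; rewrite eq_porbit_mem.
have rc x : r (c x) = r (b x) by have [-> _ _ _] := qP _ (isbb x).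
have nc x : (n <= r (c x))%N = (n <= r x)%N.
  by rewrite rc -negw (negative_porbit Ww (b_in x)) negw.
have porbit_neg v x y : v \in W n -> negative v x ->
    (sopp y \in porbit v x) = (y \in porbit v x).
  move=> Wv neg; rewrite -[RHS](mem_porbit_sopp _ _ Wv).
  by move: neg; rewrite /negative -eq_porbit_mem => /eqP ->.
have cu x y : (c y \in porbit u (c x)) = (y \in porbit w x).
  apply/idP/idP => [ucxy|xy].
    have := negative_porbit Wu ucxy; rewrite !negu !nc => nyx.
    have rcy : r (c y) = r (c x) by rewrite !rc !rb !negw nyx.
    have same z : c y = c z -> porbit w y = porbit w z.
      move/(q_inj _ _ (isbb y) (isbb z)) => byz; apply/eqP; rewrite eq_porbit_mem.
      have := b_in y; rewrite byz; have := b_in z; rewrite -!eq_porbit_mem.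
      by move=> /eqP -> /eqP ->.
    have [/same yx|cyE] := ru_inj _ _ ucxy rcy; first by rewrite -yx porbit_id.
    move: ucxy; rewrite cyE -cs => neg; have := neg; rewrite cs -/(negative u (c x)).
    rewrite negu nc -negw => negx; rewrite -porbit_neg //.
    have := same (sopp x); rewrite cs => /(_ cyE) yx.
    by rewrite -mem_porbit_sopp // soppK -yx porbit_id.
  have nyx : (n <= r y)%N = (n <= r x)%N by rewrite -!negw; apply: negative_porbit.
  have bxy : b y \in porbit w (b x).
    have := b_in x; have := b_in y; rewrite -!eq_porbit_mem => /eqP -> /eqP ->.
    by rewrite eq_porbit_mem.
  have rbyx : r (b y) = r (b x) by rewrite !rb !negw nyx.
  have [byx|byE] := rw_inj _ _ bxy rbyx; first by rewrite /c byx porbit_id.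
  rewrite /c byE qs porbit_neg ?porbit_id // negu -/(c x) nc -negw.
  by rewrite -(negative_porbit Ww (b_in x)) /negative -byE.
have [h Wh hP] := rank_lift Wu Ww rkw rku cs cu cc.
have [|x|g Wg ->] := @same_porbits_conj n u (w ^ h) Wu.
- by rewrite groupJ.
- rewrite -[x](permKV h); set y := h^-1 x; rewrite porbitJ; apply/esym/eqP.
  have hu z : porbit u (h z) = porbit u (c z).
    by apply/eqP; rewrite eq_porbit_mem; case: (hP z).
  rewrite eqEcard (card_imset _ perm_inj) hu cc leqnn andbT.
  apply/subsetP => _ /imsetP[z yz ->]; rewrite -eq_porbit_mem hu.
  by rewrite eq_porbit_mem cu.
by exists (h * g); rewrite ?groupM // conjgM.
Qed.

End RankingConjugacy.

(** * Induced linear characters against permutation characters *)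

Section LinearPairing.
Local Open Scope group_scope.
Local Open Scope ring_scope.
Variables (gT : finGroupType).

Lemma sign_lin_char (P : {group gT}) (d : gT -> bool) :
  {in P &, forall x y, d (x * y)%g = d x (+) d y} ->
  exists2 xi : 'CF(P), xi \is a linear_char &
    forall x, x \in P -> xi x = (-1) ^+ d x.
Proof.
move=> dM; have d1 : d 1%g = false.
  by have := dM _ _ (group1 P) (group1 P); rewrite mulg1; case: (d 1%g).
have rP : mx_repr P (fun x => ((-1) ^+ d x : algC)%:M : 'M_1).
  split=> [|x y Px Py]; first by rewrite d1.
  by rewrite dM // signr_addb scalar_mxM.
exists (cfRepr (MxRepresentation rP)) => [|x Px]; last first.
  by rewrite cfunE Px mulr1n /= mxtrace_scalar mulr1n.
by rewrite qualifE /= cfRepr_char cfRepr1 eqxx.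
Qed.

(** The restriction of xi to Q is irreducible, hence orthogonal to 1 unless it
    is trivial. *)
Lemma sum_lin_char (P Q : {group gT}) (xi : 'CF(P)) :
  Q \subset P -> xi \is a linear_char ->
  \sum_(y in Q) xi y = if Q \subset cfker xi then #|Q|%:R else 0.
Proof.
move=> sQP lin_xi; have lin_Q := cfRes_lin_char Q lin_xi.
have -> : \sum_(y in Q) xi y = #|Q|%:R * '['Res[Q] xi, 1].
  rewrite cfdotE mulVKf ?pnatr_eq0 -?lt0n ?cardG_gt0 //.
  by apply: eq_bigr => y Qy; rewrite cfResE // cfun1E Qy rmorph1 mulr1.
have /irrP[i Ei] := lin_char_irr lin_Q.
rewrite Ei -irr0 cfdot_irr -(inj_eq irr_inj) -Ei irr0.
suff -> : ('Res[Q] xi == 1) = (Q \subset cfker xi).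
  by case: ifP; rewrite ?mulr1 ?mulr0.
apply/eqP/subsetP => [res1 y Qy|kerQ].
  rewrite cfkerEchar ?lin_charW // inE (subsetP sQP) //= lin_char1 //.
  by rewrite -(cfResE xi sQP Qy) res1 cfun1E Qy.
apply/cfun_inP => y Qy; rewrite cfResE // cfun1E Qy.
have := kerQ y Qy; rewrite cfkerEchar ?lin_charW // inE lin_char1 //.
by case/andP=> _ /eqP.
Qed.

(** Mackey: a double coset contributes if and only if xi is trivial on the
    corresponding intersection. *)
Lemma cfdot_permchar_Ind (G H P : {group gT}) (xi : 'CF(P)) :
  H \subset G -> P \subset G -> xi \is a linear_char ->
  '['Ind[G] xi, permchar G H] =
  (#|H| * #|P|)%:R^-1 *
  \sum_(g in G | (H :^ g :&: P \subset cfker xi)%g) #|(H :^ g :&: P)%g|%:R.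
Proof.
move=> sHG sPG lin_xi; rewrite -Frobenius_reciprocity cfdotE.
rewrite mulnC natrM invfM -mulrA; congr (_ * _).
transitivity (#|H|%:R^-1 *
    \sum_(g in G) \sum_(y in P) xi y * ((y ^ g)%g \in H)%:R).
  rewrite exchange_big /= mulr_sumr; apply: eq_bigr => y Py.
  rewrite cfResE // permcharE // rmorphM fmorphV rmorph_nat rmorph_sum mulrCA.
  rewrite mulr_sumr; congr (_ * _); apply: eq_bigr => g _.
  by rewrite rmorph_nat.
congr (_ * _); rewrite (reindex_inj invg_inj) /= [RHS]big_mkcondr /=.
apply: eq_big => [g|g _]; first by rewrite groupV.
rewrite -(sum_lin_char (Q := (H :^ g :&: P)%G)) ?subsetIr //.
rewrite [RHS](eq_bigl (fun y => (y \in P) && (y \in (H :^ g)%g))) => [|y].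
  rewrite [RHS]big_mkcondr /=; apply: eq_bigr => y _; rewrite mem_conjg.
  by case: ifP; rewrite ?mulr1 ?mulr0.
by rewrite inE andbC.
Qed.

End LinearPairing.

Lemma restr_tperm (T : finType) (A : {set T}) x y : (x \in A) = (y \in A) ->
  tperm x y \in ('N(A | 'P))%g /\
  restr_perm A (tperm x y) = (if x \in A then tperm x y else 1%g).
Proof.
move=> xy; have nA : tperm x y \in ('N(A | 'P))%g.
  rewrite inE /=; apply/andP; split; first by rewrite inE.
  rewrite inE; apply/subsetP => z Az; rewrite inE /= apermE.
  by case: tpermP Az => // ->; rewrite xy.
split=> //; apply/permP => z; have [Az|nAz] := boolP (z \in A).
  rewrite restr_permE //; case: ifP => // nAx; rewrite perm1 tpermD //.
    by apply: contraFneq nAx => ->.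
  by apply: contraFneq nAx; rewrite xy => ->.
rewrite (out_perm (restr_perm_on _ _)) //; case: ifP => // Ax; last by rewrite perm1.
rewrite tpermD //; first by apply: contraNneq nAz => <-.
by apply: contraNneq nAz => <-; rewrite -xy.
Qed.

Section SignCharacter.
Local Open Scope group_scope.
Variable n : nat.
Implicit Types (g h u w : {perm signed n}) (x y z : signed n) (r : signed n -> nat).

(** The permutation of the pairs {x, -x}; insubd extends the definition to all
    the permutations of the signed points. *)
Definition pairperm g : {perm 'I_n} :=
  insubd (1 : {perm 'I_n}) [ffun i => (g (i, false)).1].

Lemma fst_eq x y : x.1 = y.1 -> x = y \/ x = sopp y.
Proof.
case: x y => [i b] [j c] /= ->; rewrite /sopp /=.
by case: b; case: c; [left|right|right|left].
Qed.

Lemma pairpermE g x : g \in W n -> pairperm g x.1 = (g x).1.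
Proof.
move=> Wg; have gE y : (g (y.1, false)).1 = (g y).1.
  by case: y => i [] //=; rewrite -[(i, true)]/(sopp (i, false)) W_sopp.
have inj : injectiveb [ffun i : 'I_n => (g (i, false)).1].
  apply/injectiveP => i j; rewrite !ffunE => /fst_eq[/perm_inj[]//|].
  by rewrite -W_sopp // => /perm_inj [].
by rewrite -pvalE [pval _]val_insubd inj ffunE gE.
Qed.

Lemma pairpermM g h : g \in W n -> h \in W n ->
  pairperm (g * h) = pairperm g * pairperm h.
Proof.
move=> Wg Wh; apply/permP => i; rewrite permM -[i]/((i, false).1).
by rewrite !pairpermE ?groupM // permM.
Qed.

Definition low r : {set signed n} := [set x | (r x < n)%N].

Definition rank_stab_set r := [set g in W n | [forall x, r (g x) == r x]].

Lemma rank_stabP r g :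
  reflect (g \in W n /\ forall x, r (g x) = r x) (g \in rank_stab_set r).
Proof.
apply: (iffP idP) => [|[Wg rg]]; last first.
  by rewrite in_set; apply/andP; split=> //; apply/forallP => x; rewrite rg.
by rewrite in_set => /andP[Wg /forallP rg]; split=> // x; apply/eqP.
Qed.

Lemma rank_stab_is_group r : group_set (rank_stab_set r).
Proof.
apply/group_setP; split=> [|g h];
  first by apply/rank_stabP; split=> // x; rewrite perm1.
move=> /rank_stabP[Wg rg] /rank_stabP[Wh rh]; apply/rank_stabP.
by split=> [|x]; rewrite ?groupM // permM rh rg.
Qed.
Canonical rank_stab r := Group (rank_stab_is_group r).

Lemma rank_stab_sub r : rank_stab r \subset W n.
Proof. by apply/subsetP => g /rank_stabP[]. Qed.

(** The exponent of the product of two signs: that of the permutation of the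
    pairs {x, -x} and that of the permutation of the points of low rank. It is
    chosen so as to be nontrivial on any exchange of two pairs, and on the
    sign changes at low rank, but trivial on the sign changes at high rank. *)
Definition sign_exp r g : bool :=
  odd_perm (pairperm g) (+) odd_perm (restr_perm (low r) g).

Lemma rank_stab_norm r g : g \in rank_stab r -> g \in 'N(low r | 'P).
Proof.
case/rank_stabP=> _ rg; rewrite inE /=; apply/andP; split; first by rewrite inE.
by rewrite inE; apply/subsetP => x; rewrite !inE /= apermE rg.
Qed.

Lemma sign_expM r : {in rank_stab r &, forall g h,
  sign_exp r (g * h) = sign_exp r g (+) sign_exp r h}.
Proof.
move=> g h rg rh; rewrite /sign_exp pairpermM ?(subsetP (rank_stab_sub r)) //.
have -> : restr_perm (low r) (g * h) = restr_perm (low r) g * restr_perm (low r) h.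
  by rewrite morphM ?rank_stab_norm.
by rewrite !odd_permM addbACA.
Qed.

Lemma tperm_porbit u x y z : y \in porbit u x -> tperm x y z \in porbit u z.
Proof. by move=> xy; case: tpermP => [->|->|_ _]; rewrite ?porbit_id // porbit_sym. Qed.

Lemma sopp_tperm x y z : sopp (tperm x y z) = tperm (sopp x) (sopp y) (sopp z).
Proof. exact: inj_tperm (can_inj (@soppK n)). Qed.

Section Exchange.
Variables (r : signed n -> nat) (x y : signed n).
Hypotheses (rs : forall z, r (sopp z) = r z) (rxy : r y = r x).

Lemma flip_sign : (r x < n)%N ->
  tperm x (sopp x) \in rank_stab r /\ sign_exp r (tperm x (sopp x)).
Proof.
move=> lt; have Wt : tperm x (sopp x) \in W n.
  by apply: W_mem => z; rewrite sopp_tperm soppK tpermC.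
split; first by apply/rank_stabP; split=> // z; case: tpermP => [->|->|//]; rewrite rs.
have lowx : (x \in low r) = (sopp x \in low r) by rewrite !inE rs.
rewrite /sign_exp (proj2 (restr_tperm lowx)) inE lt odd_tperm.
rewrite (eq_sym x) sopp_neq /= (_ : pairperm _ = 1) ?odd_perm1 //.
apply/permP => i; rewrite perm1 -[i]/((i, false).1) pairpermE //.
by case: tpermP => [->|->|//].
Qed.

Hypotheses (nyx : y != x) (nysx : y != sopp x).

(** The element of W n that exchanges the pairs of x and of y. It is a product
    of two transpositions of points, hence even there, but odd on the pairs. *)
Definition exchange := tperm x y * tperm (sopp x) (sopp y).

Lemma exchange_commute : exchange = tperm (sopp x) (sopp y) * tperm x y.
Proof.
have [sxx syy] := (sopp_neq x, sopp_neq y).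
have sxy : sopp x != y by rewrite eq_sym.
have syx : sopp y != x by apply: contraNneq nysx => <-; rewrite soppK.
by rewrite /exchange; apply/commgP/conjg_fixP; rewrite tpermJ !tpermD.
Qed.

Lemma exchange_W : exchange \in W n.
Proof.
apply: W_mem => z; rewrite {1}exchange_commute /exchange !permM.
by rewrite !sopp_tperm !soppK.
Qed.

Lemma exchange_sign : exchange \in rank_stab r /\ sign_exp r exchange.
Proof.
split.
  apply/rank_stabP; split; first exact: exchange_W.
  have rt a b z : r b = r a -> r (tperm a b z) = r z by case: tpermP => [->|->|].
  by move=> z; rewrite permM !rt ?rs.
have l1 : (x \in low r) = (y \in low r) by rewrite !inE rxy.
have l2 : (sopp x \in low r) = (sopp y \in low r) by rewrite !inE !rs rxy.
have [n1 E1] := restr_tperm l1; have [n2 E2] := restr_tperm l2.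
have E : restr_perm (low r) exchange =
    restr_perm (low r) (tperm x y) * restr_perm (low r) (tperm (sopp x) (sopp y)).
  by rewrite /exchange morphM.
rewrite /sign_exp E E1 E2.
have -> : (sopp x \in low r) = (x \in low r) by rewrite !inE rs.
have -> : odd_perm ((if x \in low r then tperm x y else 1) *
    (if x \in low r then tperm (sopp x) (sopp y) else 1)) = false.
  case: ifP; rewrite ?mulg1 ?odd_perm1 // odd_permM !odd_tperm.
  by rewrite (can_eq (@soppK n)) addbb.
rewrite addbF (_ : pairperm _ = tperm x.1 y.1).
  rewrite odd_tperm; apply/eqP => /fst_eq[xy|xy].
    by move: nyx; rewrite xy eqxx.
  by move: nysx; rewrite xy soppK eqxx.
apply/permP => i; rewrite -[i]/((i, false).1) pairpermE ?exchange_W //.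
set z := (i, false); rewrite /exchange permM.
have [sxx syy] := (sopp_neq x, sopp_neq y).
have sxy : sopp x != y by rewrite eq_sym.
have syx : sopp y != x by apply: contraNneq nysx => <-; rewrite soppK.
have [/fst_eq[->|->]|nzx] := eqVneq z.1 x.1.
- by rewrite !tpermL tpermD.
- by rewrite (tpermD (x := x)) ?(eq_sym x) // tpermL /= tpermL.
have [/fst_eq[->|->]|nzy] := eqVneq z.1 y.1.
- by rewrite !tpermR tpermD.
- by rewrite (tpermD (x := x)) ?(eq_sym x) ?(eq_sym y) // tpermR /= tpermR.
have neq a : z.1 != a.1 -> a != z by apply: contraNneq => ->.
by rewrite !tpermD ?neq // eq_sym.
Qed.

End Exchange.

(** If two points of one cycle of u, not opposite to each other, had the same
    rank, then exchanging their pairs would preserve the cycles and the ranks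
    with sign -1; so would the transposition of x and -x for a point x of low
    rank in a negative cycle. *)
Lemma sign_trivial_transversal u r : u \in W n -> (forall x, r (sopp x) = r x) ->
  (forall g, g \in block_group u -> g \in rank_stab r -> ~~ sign_exp r g) ->
  level_transversal u r.
Proof.
move=> Wu rs trivial_sign; split=> // [x y xy rxy|x neg].
  have [->|nyx] := eqVneq y x; first by left.
  have [->|nysx] := eqVneq y (sopp x); first by right.
  have [stab sgn] := exchange_sign rs rxy nyx nysx.
  suff ug : exchange x y \in block_group u.
    by have := trivial_sign _ ug stab; rewrite sgn.
  rewrite block_groupE exchange_W //.
  apply/forallP => z; rewrite permM.
  have := tperm_porbit (tperm x y z) (_ : sopp y \in porbit u (sopp x)).
  rewrite mem_porbit_sopp // => /(_ xy).
  have := tperm_porbit z xy; rewrite -!eq_porbit_mem => /eqP <-.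
  by [].
rewrite leqNgt; apply/negP => lt; have [stab sgn] := flip_sign rs lt.
suff ug : tperm x (sopp x) \in block_group u.
  by have := trivial_sign _ ug stab; rewrite sgn.
 rewrite block_groupE.
rewrite W_mem => [/=|z]; last by rewrite sopp_tperm soppK tpermC.
by apply/forallP => z; apply: tperm_porbit.
Qed.

(** An element that preserves both the cycles and the ranks can only change
    signs, and only at the points of negative cycles, which have high rank. *)
Lemma ranking_sign_trivial u r g : u \in W n -> ranking u r ->
  g \in block_group u -> g \in rank_stab r -> sign_exp r g = false.
Proof.
move=> Wu rk; rewrite block_groupE => /andP[Wg /forallP ug] /rank_stabP[_ rg].
have [[rs r_inj rn] _] := rk.
have gx x : g x = x \/ g x = sopp x := r_inj x (g x) (ug x) (rg x).
have pair1 : pairperm g = 1.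
  apply/permP => i; rewrite perm1 -[i]/((i, false).1) pairpermE //.
  by case: (gx (i, false)) => ->.
have restr1 : restr_perm (low r) g = 1.
  apply/permP => x; rewrite perm1; have [lx|nlx] := boolP (x \in low r).
    rewrite restr_permE //; last by apply: rank_stab_norm; apply/rank_stabP.
    have [//|gs] := gx x; move: lx; rewrite inE ltnNge => /negP[].
    by apply: rn; rewrite /negative -gs.
  by rewrite (out_perm (restr_perm_on _ _)).
by rewrite /sign_exp pair1 restr1 !odd_perm1.
Qed.

End SignCharacter.

(** * The dual family *)

Section Duality.
Local Open Scope group_scope.
Variable n : nat.
Implicit Types (g h u v w : {perm signed n}) (x y z : signed n) (r : signed n -> nat).

Lemma rankingJ v g r : v \in W n -> g \in W n -> ranking v r ->
  ranking (v ^ g) (fun x => r (g^-1 x)).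
Proof.
move=> Wv Wg [[rs r_inj rn] lt]; have Wg' : g^-1 \in W n by rewrite groupV.
have pE x y : (y \in porbit (v ^ g) x) = (g^-1 y \in porbit v (g^-1 x)).
  rewrite -{1}[x](permKV g) porbitJ -{1}[y](permKV g) mem_imset //.
  exact: perm_inj.
have nE x : negative (v ^ g) x = negative v (g^-1 x).
  by rewrite /negative pE W_sopp.
split; first split.
- by move=> x; rewrite W_sopp.
- move=> x y; rewrite pE => /r_inj H /H[/perm_inj|]; first by left.
  by rewrite -W_sopp // => /perm_inj; right.
- by move=> x; rewrite nE => /rn.
move=> x; rewrite nE; have := lt (g^-1 x).
suff -> : #|porbit (v ^ g) x| = #|porbit v (g^-1 x)| by [].
by rewrite -{1}[x](permKV g) porbitJ card_imset //; apply: perm_inj.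
Qed.

Lemma sum_rankJ g r : \sum_x r (g^-1 x) = \sum_x r x.
Proof. by rewrite [RHS](reindex_inj (@perm_inj _ g^-1)). Qed.

Section DualCharacter.
Variables (w : {perm signed n}) (r : signed n -> nat).
Hypotheses (Ww : w \in W n) (rk : ranking w r).
Variable xi : 'CF(rank_stab r).
Hypotheses (lin_xi : xi \is a linear_char)
  (xiE : forall g, g \in rank_stab r -> xi g = ((-1) ^+ sign_exp r g)%R).

Lemma mem_cfker_sign g : g \in rank_stab r ->
  (g \in cfker xi) = ~~ sign_exp r g.
Proof.
move=> rg; rewrite cfkerEchar ?lin_charW // [LHS]inE rg lin_char1 // xiE //=.
by case: (sign_exp r g); rewrite ?eqxx // expr1 eqNr oner_eq0.
Qed.

Lemma kernel_transversal v g : v \in W n -> g \in W n ->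
  (block_group v :^ g :&: rank_stab r)%g \subset cfker xi ->
  level_transversal (v ^ g) r.
Proof.
move=> Wv Wg /subsetP ker; apply: sign_trivial_transversal.
- by rewrite groupJ.
- by case: rk => [[]].
move=> h uh sh; rewrite -mem_cfker_sign //; apply: ker.
by rewrite inE sh andbT block_groupJ.
Qed.

(** The orbits of v ^ g are transversal to the levels of r, and rv transports
    to a ranking of v ^ g with the same sum. *)
Lemma kernel_sum v rv g : v \in W n -> g \in W n -> ranking v rv ->
  (block_group v :^ g :&: rank_stab r)%g \subset cfker xi ->
  \sum_x rv x <= \sum_x r x /\ (\sum_x rv x = \sum_x r x -> ranking (v ^ g) r).
Proof.
move=> Wv Wg rkv ker; have Wu : v ^ g \in W n by rewrite groupJ.
have := transversal_sum Wu (kernel_transversal Wv Wg ker) (rankingJ Wv Wg rkv).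
by rewrite sum_rankJ.
Qed.

(** If xi is trivial on the intersection, then r is a ranking of w ^ g, as
    well as of w; the correspondence g between the cycles lifts to an element
    h that preserves r, and g and h differ by an element of the group of w. *)
Lemma kernel_double_coset g : g \in W n ->
  ((block_group w :^ g :&: rank_stab r)%g \subset cfker xi) =
  (g \in block_group w * rank_stab r)%g.
Proof.
move=> Wg; apply/idP/mulsgP => [ker|[k h Hk Ph ->]]; last first.
  rewrite conjsgM (conjGid Hk) -{1}(conjGid Ph) -conjIg.
  apply/subsetP => _ /imsetP[z /setIP[Hz Pz] ->].
  rewrite memJ_norm ?mem_cfker_sign ?(ranking_sign_trivial Ww rk) //.
  by rewrite (subsetP (cfker_norm xi)).
have [_ rku] := kernel_sum Ww Wg rk ker; have {}rku := rku erefl.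
have Wu : w ^ g \in W n by rewrite groupJ.
have [|x y|x|h Wh hP] := rank_lift (b := g) Wu Ww rk rku.
- by move=> x; rewrite W_sopp.
- by rewrite porbitJ mem_imset //; apply: perm_inj.
- by rewrite porbitJ card_imset //; apply: perm_inj.
have : g^-1 * h \in block_group (w ^ g).
  rewrite block_groupE groupM ?groupV //; apply/forallP => x.
  by rewrite permM; have [_] := hP (g^-1 x); rewrite permKV.
rewrite -block_groupJ // mem_conjg conjgE invgK !mulgA mulgV mul1g => Hk.
exists (h * g^-1)^-1 h; rewrite ?groupV //; last by rewrite invMg invgK mulgKV.
by apply/rank_stabP; split=> // x; case: (hP x).
Qed.

Lemma dual_pairing1 : '['Ind[W n] xi, permchar (W n) (block_group w)]%R = 1%R.
Proof.
rewrite cfdot_permchar_Ind ?block_group_sub ?rank_stab_sub //.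
set H := block_group w; set P := rank_stab r.
have sHP : (H * P \subset W n)%g by rewrite mul_subG ?block_group_sub ?rank_stab_sub.
rewrite (eq_big (mem (H * P)%g) (fun=> (#|(H :&: P)%g|%:R)%R)) => [|g|g].
- rewrite sumr_const -[X in (_ * X)%R]mulr_natr -natrM.
  rewrite [X in (_ * X%:R)%R](_ : _ = (#|H| * #|P|)%N); last by rewrite mulnC mul_cardG.
  by rewrite mulVf // pnatr_eq0 -lt0n muln_gt0 !cardG_gt0.
- have [Wg|nWg] := boolP (g \in W n); first exact: kernel_double_coset.
  by apply/esym/negbTE; apply: contra nWg; apply: subsetP.
case/andP=> Wg; rewrite kernel_double_coset // => /mulsgP[k h Hk Ph ->].
by rewrite conjsgM (conjGid Hk) -{1}(conjGid Ph) -conjIg cardJg.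
Qed.

Lemma dual_pairing0 v rv : v \in W n -> ranking v rv ->
  '['Ind[W n] xi, permchar (W n) (block_group v)]%R != 0%R ->
  \sum_x rv x <= \sum_x r x /\
  (\sum_x rv x = \sum_x r x -> exists2 g, g \in W n & v = w ^ g).
Proof.
move=> Wv rkv; rewrite cfdot_permchar_Ind ?block_group_sub ?rank_stab_sub // => nz.
have [g /andP[Wg ker]] : exists g, (g \in W n) &&
    ((block_group v :^ g :&: rank_stab r)%g \subset cfker xi).
  apply/existsP; apply: contraNT nz => /existsPn no.
  by rewrite big_pred0 ?mulr0 // => g; apply/negbTE.
have [le eq] := kernel_sum Wv Wg rkv ker; split=> // /eq rku.
have [||h Wh vg] := ranking_conj _ _ rku rk; rewrite ?groupJ //.
exists (h * g^-1); first by rewrite groupM ?groupV.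
by rewrite conjgM -vg conjgK.
Qed.

End DualCharacter.

(** Here psi w is induced from the sign character of the stabiliser of a ranking
    of w, and R w is the sum of the ranks. In an order with nondecreasing R, the
    matrix of pairings is unitriangular. *)
Lemma dual_characters : exists R : {perm signed n} -> nat,
  exists psi : {perm signed n} -> 'CF(W n), forall w, w \in W n ->
  [/\ psi w \in 'Z[irr (W n)],
      '[psi w, permchar (W n) (block_group w)]%R = 1%R
    & forall v, v \in W n ->
        '[psi w, permchar (W n) (block_group v)]%R != 0%R ->
        R v <= R w /\ (R v = R w -> exists2 g, g \in W n & v = w ^ g)].
Proof.
have /boolp.choice[rk rkP] : forall w, exists r, w \in W n -> ranking w r.
  move=> w; have [Ww|nWw] := boolP (w \in W n); last by exists (fun=> 0%N).
  by have [r rk] := ranking_exists Ww; exists r.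
have /boolp.choice[psi psiP] : forall w, exists psi : 'CF(W n),
    exists2 xi : 'CF(rank_stab (rk w)), psi = ('Ind[W n] xi)%R &
    xi \is a linear_char /\
    (forall g, g \in rank_stab (rk w) -> xi g = ((-1) ^+ sign_exp (rk w) g)%R).
  move=> w; have [xi lin_xi xiE] := sign_lin_char (@sign_expM n (rk w)).
  by exists ('Ind[W n] xi)%R; exists xi.
exists (fun w => \sum_x rk w x); exists psi => w Ww.
have [xi -> [lin_xi xiE]] := psiP w; split.
- by rewrite cfInd_vchar ?char_vchar ?lin_charW.
- exact: (dual_pairing1 Ww (rkP w Ww) lin_xi xiE).
move=> v Wv; apply: (dual_pairing0 Ww (rkP w Ww) lin_xi xiE Wv (rkP v Wv)).
Qed.

End Duality.

(** * An integral basis of the character ring *)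

Section IntegralSpan.
Local Open Scope group_scope.
Local Open Scope ring_scope.

(** Solving a unitriangular system by induction on R. For S one takes the
    integers or the zero subgroup, which gives integrality and independence at
    once. *)
Lemma unitriangular_coeff (I : finType) (M : I -> I -> algC) (R : I -> nat)
    (q : I -> algC) (S : algC -> Prop) :
  (forall i, M i i = 1) ->
  (forall i j, M i j != 0 -> (R i <= R j)%N /\ (R i = R j -> i = j)) ->
  (forall x y, S x -> S y -> S (x - y)) ->
  (forall x i j, S x -> S (x * M i j)) ->
  (forall j, S (\sum_i q i * M i j)) -> forall j, S (q j).
Proof.
move=> M1 Mtri SB SM Sq j.
have S0 : S 0 by rewrite -(subrr (\sum_i q i * M i j)); apply: (SB).
have SD x y : S x -> S y -> S (x + y).
  by move=> Sx Sy; rewrite -[y]opprK; apply: (SB) => //; rewrite -sub0r; apply: (SB).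
have [m] := ubnP (R j); elim: m => // m IHm in j * => leRm.
have := Sq j; rewrite (bigD1 j) //= M1 mulr1 => Sj.
rewrite -[q j](addrK (\sum_(i | i != j) q i * M i j)); apply: (SB) => //.
apply: (big_ind S) => // i neq_ij.
have [->|/Mtri[le_ij eq_ij]] := eqVneq (M i j) 0; first by rewrite mulr0.
apply/SM/IHm; rewrite -ltnS (leq_trans _ leRm) // ltnS ltn_neqAle le_ij andbT.
by apply: contra neq_ij => /eqP/eq_ij ->.
Qed.

Variable n : nat.
Local Notation k := #|classes (W n)|.

Definition class_rep (i : 'I_k) : {perm signed n} := repr (enum_val i : {set _}).

Lemma class_rep_W i : class_rep i \in W n.
Proof.
by have /repr_classesP[] := enum_valP i.
Qed.

Lemma class_rep_conj i j g :
  g \in W n -> class_rep i = (class_rep j ^ g)%g -> i = j.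
Proof.
move=> Wg xij; apply: enum_val_inj.
have /repr_classesP[_ ->] := enum_valP i; have /repr_classesP[_ ->] := enum_valP j.
rewrite -/(class_rep i) -/(class_rep j) xij.
by apply/class_eqP; rewrite memJ_class.
Qed.

Definition block_char (i : 'I_k) : 'CF(W n) :=
  permchar (W n) (block_group (class_rep i)).

(** The block characters are linearly independent, and there are as many of
    them as classes; the coefficients are integers because the pairings with
    the dual family are. *)
Lemma vchar_block_char phi : phi \in 'Z[irr (W n)] ->
  exists a : 'I_k -> int, phi = \sum_i (a i)%:~R *: block_char i.
Proof.
move=> Zphi; have [R [psi psiP]] := dual_characters n.
pose M i j := '[block_char i, psi (class_rep j)].
have Mint i j : M i j \in Num.int.
  rewrite Cint_cfdot_vchar ?permchar_vchar //.
  by have [] := psiP _ (class_rep_W j).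
have MC i j : M i j = '[psi (class_rep j), block_char i].
  by rewrite /M cfdotC conj_Creal // Rreal_int // Cint_cfdot_vchar ?permchar_vchar //;
    have [] := psiP _ (class_rep_W j).
have M1 i : M i i = 1 by rewrite MC; have [] := psiP _ (class_rep_W i).
have Mtri i j : M i j != 0 ->
    (R (class_rep i) <= R (class_rep j))%N /\
    (R (class_rep i) = R (class_rep j) -> i = j).
  rewrite MC => nz; have [_ _ tri] := psiP _ (class_rep_W j).
  have [le eq] := tri _ (class_rep_W i) nz; split=> // /eq[g Wg].
  exact: class_rep_conj.
have dotE (q : 'I_k -> algC) j :
    '[\sum_i q i *: block_char i, psi (class_rep j)] = \sum_i q i * M i j.
  by rewrite cfdot_suml; apply: eq_bigr => i _; rewrite cfdotZl.
pose X := [tuple block_char i | i < k].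
have XE (i : 'I_k) : X`_i = block_char i by rewrite -tnth_nth tnth_mktuple.
have freeX : free X.
  apply/freeP => q q0 i; apply: (unitriangular_coeff (S := eq^~ 0) M1 Mtri) => /=.
  - by move=> x y -> ->; rewrite subrr.
  - by move=> x i' j' ->; rewrite mul0r.
  move=> j; rewrite -dotE; suff -> : \sum_i q i *: block_char i = 0 by rewrite cfdot0l.
  by rewrite -[RHS]q0; apply: eq_bigr => l _; rewrite XE.
have basisX : basis_of 'CF(W n)%VS X.
  by rewrite basisEfree freeX subvf size_tuple dim_cfun leqnn.
pose q i := coord X i phi.
have phiE : phi = \sum_i q i *: block_char i.
  rewrite {1}(coord_basis basisX (memvf phi)).
  by apply: eq_bigr => i _; rewrite XE.
have Zq i : q i \in Num.int.
  apply: (unitriangular_coeff (S := fun x => x \in Num.int) M1 Mtri).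
  - by move=> x y; apply: rpredB.
  - by move=> x i' j' Zx; apply: rpredM.
  move=> j; rewrite -dotE -phiE Cint_cfdot_vchar //.
  by have [] := psiP _ (class_rep_W j).
exists (fun i => Num.floor (q i)); rewrite {1}phiE.
by apply: eq_bigr => i _; rewrite floorK.
Qed.

Lemma vchar_W_int (phi : 'CF(W n)) x : phi \in 'Z[irr (W n)] -> phi x \in Num.int.
Proof.
case/vchar_block_char=> a ->; rewrite sum_cfunE rpred_sum // => i _.
rewrite cfunE rpredM ?intr_int //.
rewrite /block_char; have [m ->] := permchar_norm x (block_group_sub (class_rep i)).
exact: rpred_nat.
Qed.

End IntegralSpan.

(** * The radical and its powers *)

Section RadicalOfKIrrW.
Local Open Scope group_scope.
Local Open Scope ring_scope.
Variables (K : fieldType) (n : nat).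
Local Notation k := #|classes (W n)|.
Local Notation io := (@KIrr_of_vchar K _ (W n)).
Implicit Types (w : {perm signed n}) (i j : 'I_k).

Lemma KIrr_block_char (u : KIrr K (W n)) :
  exists c : 'I_k -> K, u = \sum_i c i *: io (block_char i).
Proof.
have /boolp.choice[a aE] : forall j : Iirr (W n), exists a : 'I_k -> int,
    'chi_j = \sum_i (a i)%:~R *: block_char i.
  by move=> j; apply/vchar_block_char/irr_vchar.
exists (fun i => \sum_j u 0 j * (a j i)%:~R).
rewrite {1}[u]KIrr_sum_irr.
under eq_bigr => j _.
  rewrite (aE j) KIrr_of_vchar_sum; last by move=> i; apply: permchar_vchar.
  rewrite scaler_sumr; over.
rewrite exchange_big; apply: eq_bigr => i _; rewrite scaler_suml.
by apply: eq_bigr => j _; rewrite scalerA.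
Qed.

(** This is the value of the block character at its own class representative.
    When it is zero in K, all the values of the block character are. *)
Definition block_index i : nat :=
  #|'N_(W n)(block_group (class_rep i)) : block_group (class_rep i)|%g.

(** If w ^ y lies in the group H of w, then H contains the conjugate of H by
    y, so y normalises H. *)
Lemma block_char_self i : block_char i (class_rep i) = (block_index i)%:R.
Proof.
set w := class_rep i; have Ww : w \in W n by apply: class_rep_W.
rewrite /block_char -/w permcharE ?block_group_sub //.
set H := block_group w.
have sHN : H \subset 'N_(W n)(H)%G by rewrite subsetI block_group_sub normG.
have E y : y \in W n -> ((w ^ y)%g \in H) = (y \in 'N_(W n)(H)%g).
  move=> Wy; rewrite [RHS]inE Wy /=; apply/idP/normP => [Hwy|nHy].
    apply/eqP; rewrite eqEcard cardJg leqnn andbT.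
    by rewrite block_groupJ // block_group_min.
  by rewrite -nHy memJ_conjg mem_block_group.
have nzH : (#|H|%:R : algC) != 0 by rewrite pnatr_eq0 -lt0n cardG_gt0.
transitivity (#|H|%:R^-1 * (#|'N_(W n)(H)%g|%:R) : algC).
  congr (_ * _); rewrite -natr_sum; congr _%:R.
  rewrite -sum1_card [RHS](eq_bigl (fun y => (y \in W n) && ((w ^ y)%g \in H))) => [|y].
    by rewrite [RHS]big_mkcondr; apply: eq_bigr => y _; case: (_ \in H).
  have [Wy|nWy] := boolP (y \in W n); first by rewrite E.
  by rewrite inE (negPf nWy).
by rewrite -(Lagrange sHN) natrM mulKf.
Qed.

Lemma block_char_dvd i x : exists m, block_char i x = (block_index i * m)%:R.
Proof. exact: permchar_norm (block_group_sub _). Qed.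

(** A fixed point of w on the cosets of H gives a conjugate of w in H, hence a
    conjugate of the group of w inside H. *)
Lemma block_char_neq0 i j : block_char i (class_rep j) != 0 ->
  (#|block_group (class_rep i)| <= #|block_group (class_rep j)|)%N -> i = j.
Proof.
rewrite /block_char permcharE ?block_group_sub //.
set H := block_group (class_rep i) => nz le_ij.
have [y Wy Hwy] : exists2 y, y \in W n & (class_rep j ^ y)%g \in H.
  apply/exists_inP; apply: contraNT nz => /exists_inPn no.
  by rewrite big1 ?mulr0 // => y Wy; rewrite (negPf (no y Wy)).
have [Wi Wj] := (class_rep_W i, class_rep_W j).
have eqH : block_group (class_rep j ^ y)%g = H :> {set _}.
  apply/eqP; rewrite eqEcard block_group_min //=.
  by rewrite -block_groupJ // cardJg.
have Wjy : (class_rep j ^ y)%g \in W n by rewrite groupJ.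
have [x|g Wg xi] := same_porbits_conj Wi Wjy.
  by rewrite -!orbit_block_group // eqH.
by apply: (class_rep_conj (g := (y * g)%g)); rewrite ?groupM // conjgM.
Qed.

(** Evaluate at a class representative whose group is largest among those that
    violate the claim. The terms with larger groups vanish since their index
    is 0 in K, the other ones by block_char_neq0. *)
Lemma Jacobson_radical_block_char (u : KIrr K (W n)) : Jacobson_radical u ->
  exists2 c : 'I_k -> K, u = \sum_i c i *: io (block_char i)
    & forall i, c i != 0 -> (block_index i)%:R = 0 :> K.
Proof.
move=> Ju; have [c uE] := KIrr_block_char u; exists c => // i ci.
apply/eqP/negPn/negP => Ni.
pose bad i := (c i != 0) && ((block_index i)%:R != 0 :> K).
have [|j /andP[cj Nj] maxj] :=
  @arg_maxnP _ i bad (fun i => #|block_group (class_rep i)|).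
  by rewrite /bad ci Ni.
have := Jacobson_radical_eval (@vchar_W_int n) (class_rep_W j) Ju.
have evE l : KIrr_eval (class_rep j) (io (block_char l)) =
    (Num.floor (block_char l (class_rep j)))%:~R.
  by apply: KIrr_eval_vchar; [exact: vchar_W_int | exact: permchar_vchar].
have floorn m : (Num.floor (m%:R : algC))%:~R = m%:R :> K.
  by rewrite -[m%:R]/(m%:Z%:~R) intrKfloor.
rewrite uE linear_sum (bigD1 j) //= big1 => [|l neq_lj].
  rewrite addr0 linearZ /= evE block_char_self floorn.
  by apply/eqP; rewrite mulf_neq0.
rewrite linearZ /= evE; have [->|cl] := eqVneq (c l) 0; first by rewrite mul0r.
have [Nl|Nl] := eqVneq ((block_index l)%:R : K) 0.
  have [m ->] := block_char_dvd l (class_rep j).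
  by rewrite floorn natrM Nl mul0r mulr0.
have [->|nz] := eqVneq (block_char l (class_rep j)) 0.
  by rewrite floor0 mulr0.
case/eqP: neq_lj; apply: block_char_neq0 nz _.
by apply: maxj; rewrite /bad cl Nl.
Qed.

Lemma Jacobson_radical_char0 (u : KIrr K (W n)) :
  [pchar K] =i pred0 -> Jacobson_radical u -> u = 0.
Proof.
move=> char0 /Jacobson_radical_block_char[c -> cP]; rewrite big1 // => i _.
have [->|/cP] := eqVneq (c i) 0; first by rewrite scale0r.
move/eqP; rewrite (proj1 (pcharf0P K) char0) => /eqP N0.
by have := indexg_gt0 'N_(W n)(block_group (class_rep i)) (block_group (class_rep i));
  rewrite -/(block_index i) N0.
Qed.

Variable p : nat.
Hypothesis pK : p \in [pchar K].

Lemma has_abelian_rank_block0 i :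
  has_abelian_rank (W n) p (@block_closed n) 0 (block_group (class_rep i)).
Proof.
apply/andP; split; first by apply: block_group_closed (class_rep_W i).
apply/existsP; exists (block_group (class_rep i)).
by rewrite block_group_sub normal_refl trivg_quotient abelian1 indexgg expn0.
Qed.

(** Cauchy's theorem in the quotient of the normaliser. *)
Lemma has_abelian_rank_block1 i : (block_index i)%:R = 0 :> K ->
  has_abelian_rank (W n) p (@block_closed n) 1 (block_group (class_rep i)).
Proof.
set H := block_group (class_rep i) => Ni.
have p_pr : prime p by case/andP: pK.
have nHN : 'N_(W n)(H)%g \subset ('N(H))%g by rewrite subsetIr.
have sHN : H \subset 'N_(W n)(H)%g by rewrite subsetI block_group_sub normG.
have : (p %| #|('N_(W n)(H) / H)%g|)%N.
  by rewrite card_quotient // (dvdn_pcharf pK) -/(block_index i) Ni.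
case/(Cauchy p_pr) => xbar Nx ox.
pose M := (coset H @*^-1 <[xbar]>)%G.
have nHM : H <| M by rewrite normal_cosetpre.
have MH : (M / H)%g = <[xbar]>%g by rewrite /quotient morphpreK // sub_im_coset.
apply/andP; split; first by apply: block_group_closed (class_rep_W i).
apply/existsP; exists M; rewrite nHM MH cycle_abelian expn1.
rewrite -card_quotient ?normal_norm // MH -orderE ox eqxx /= !andbT.
apply: subset_trans (subsetIl (W n) 'N(H)%g).
by rewrite -(quotientSGK (normal_norm nHM) sHN) MH cycle_subG.
Qed.

Lemma rank_space0_full : rank_space K (W n) p (@block_closed n) 0 = fullv.
Proof.
apply/vspaceP => u; rewrite memvf; have [c ->] := KIrr_block_char u.
apply: memv_suml => i _; apply: memvZ; apply: rank_space_mem.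
exact: has_abelian_rank_block0.
Qed.

Lemma Jacobson_radical_rank_space (u : KIrr K (W n)) : Jacobson_radical u ->
  u \in rank_space K (W n) p (@block_closed n) 1.
Proof.
case/Jacobson_radical_block_char=> c -> cP; apply: memv_suml => i _.
have [->|/cP Ni] := eqVneq (c i) 0; first by rewrite scale0r mem0v.
by apply/memvZ/rank_space_mem/has_abelian_rank_block1.
Qed.

Lemma Jacobson_radical_exp0 r (u : KIrr K (W n)) :
  ((if p == 2 then n else n %/ p) < r)%N ->
  ideal_exp (@Jacobson_radical (KIrr K (W n))) r u -> u = 0.
Proof.
move=> lt_r Iu; apply/eqP; rewrite -memv0.
have p_pr : prime p by case/andP: pK.
have := ideal_exp_rank_space pK (@block_closedJ n) (@block_closedI n)
  Jacobson_radical_rank_space rank_space0_full Iu.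
rewrite /rank_space big_pred0 // => L; apply: contraTF lt_r => rL.
rewrite -leqNgt; exact (abelian_rank_W p_pr rL).
Qed.

End RadicalOfKIrrW.

(** * A nilpotent element with a large nonzero power *)

Section PermutationCharacter.
Local Open Scope group_scope.
Local Open Scope ring_scope.
Variables (T : finType) (G : {group {perm T}}).

Lemma fixpoint_char : exists2 chi : 'CF(G), chi \in 'Z[irr G] &
  forall g, g \in G -> chi g = #|[set t | g t == t]|%:R.
Proof.
pose R (g : {perm T}) : 'M[algC]_#|T| :=
  \matrix_(i, j) (enum_val j == g (enum_val i))%:R.
have repR : mx_repr G R.
  split=> [|g h _ _]; apply/matrixP => i j; rewrite !mxE.
    by rewrite perm1 (inj_eq enum_val_inj) eq_sym.
  rewrite (bigD1 (enum_rank (g (enum_val i)))) //= !mxE enum_rankK eqxx mul1r.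
  rewrite big1 ?addr0 ?permM // => l; rewrite !mxE => nl.
  have [El|] := eqVneq (enum_val l); last by rewrite mul0r.
  by case/eqP: nl; rewrite -El enum_valK.
exists (cfRepr (MxRepresentation repR)).
  by rewrite char_vchar ?cfRepr_char.
move=> g Gg; rewrite cfunE Gg mulr1n /mxtrace /=.
have -> : #|[set t | g t == t]| = (\sum_t (g t == t))%N.
  by rewrite -sum1_card big_mkcond; apply: eq_bigr => t _; rewrite inE; case: eqP.
rewrite natr_sum [RHS](reindex (@enum_val T predT)) /=; last first.
  by apply: onW_bij; apply: enum_val_bij.
by apply: eq_bigr => i _; rewrite mxE eq_sym.
Qed.

End PermutationCharacter.

Section NilpotentElement.
Local Open Scope group_scope.
Local Open Scope ring_scope.
Variable n : nat.
Implicit Types g : {perm signed n}.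

(** On W n, half the number of signed points fixed by g. *)
Definition fixed_pairs g := #|[set i : 'I_n | g (i, false) == (i, false)]|.

Lemma card_fixpoints g : g \in W n ->
  #|[set t | g t == t]| = (fixed_pairs g).*2.
Proof.
move=> Wg; rewrite -muln2 -[X in (_ * X)%N]card_bool -cardsT -cardsX.
apply: eq_card => -[i b]; rewrite !inE andbT; case: b => //.
rewrite -[(i, true)]/(sopp (i, false)) W_sopp //.
by rewrite (can_eq (@soppK n)).
Qed.

Lemma fixed_pairs_leq g : (fixed_pairs g <= n)%N.
Proof. by rewrite (leq_trans (max_card _)) ?card_ord. Qed.

Lemma fixed_pairs_max g : g \in W n -> (fixed_pairs g == n) = (g == 1%g).
Proof.
move=> Wg; apply/eqP/eqP => [full|->]; last first.
  rewrite /fixed_pairs -[RHS]card_ord; apply: eq_card => i.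
  by rewrite inE perm1 eqxx.
have /eqP allT : [set i : 'I_n | g (i, false) == (i, false)] == setT.
  by rewrite eqEcard subsetT cardsT card_ord -/(fixed_pairs g) full leqnn.
have fix1 i : g (i, false) = (i, false).
  by have := in_setT i; rewrite -allT inE => /eqP.
apply/permP => -[i []]; rewrite perm1 ?fix1 //.
by rewrite -[(i, true)]/(sopp (i, false)) W_sopp // fix1.
Qed.

(** W n contains the products of a permutation of the pairs with sign changes. *)
Lemma card_W_geq : (2 ^ n * n`! <= #|W n|)%N.
Proof.
pose f (a : {perm 'I_n} * {ffun 'I_n -> bool}) (x : signed n) : signed n :=
  (a.1 x.1, x.2 (+) a.2 x.1).
have f_inj a : injective (f a).
  by move=> [i b] [j c] [/perm_inj ->] /addIb ->.
have WF a : perm (f_inj a) \in W n.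
  apply: W_mem => x; rewrite !permE /f /sopp /=.
  by rewrite addNb.
have F_inj : injective (fun a => perm (f_inj a)).
  move=> [s e] [t c] /permP st; congr (_, _).
    by apply/permP => i; have := st (i, false); rewrite !permE => -[].
  by apply/ffunP => i; have := st (i, false); rewrite !permE => -[_].
have cF : #|{: {perm 'I_n} * {ffun 'I_n -> bool}}| = (2 ^ n * n`!)%N.
  by rewrite card_prod card_Sn card_ffun card_bool card_ord mulnC.
rewrite -cF -(card_imset _ F_inj); apply: subset_leq_card.
by apply/subsetP => _ /imsetP[a _ ->].
Qed.

(** x is the permutation character on the signed points. As x(g) = 2a with a
    <= n, and a < n unless g = 1, the first product vanishes everywhere and
    the second one away from 1, where it is 2 ^ n n!. Hence its inner product
    with 1 is a positive integer, at most 1 by card_W_geq. *)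
Lemma vanishing_product_char : exists2 x : ZIrr (W n),
  \prod_(i < n.+1) (x - (2 * i)%:R) = 0 &
  '[zirr_val (\prod_(i < n) (x - (2 * i)%:R)), 1] = 1.
Proof.
have [chi Zchi chiE] := fixpoint_char (W n).
pose x := MkZIrr Zchi.
have natE k g : g \in W n -> (k%:R : 'CF(W n)) g = k%:R.
  by move=> Wg; rewrite -scaler_nat cfunE cfun1E Wg mulr1.
have valE m g : g \in W n -> zirr_val (\prod_(i < m) (x - (2 * i)%:R)) g =
    \prod_(i < m) ((2 * fixed_pairs g)%:R - (2 * i)%:R).
  move=> Wg; rewrite -[zirr_val _]/(val _) rmorph_prod prod_cfunE //.
  apply: eq_bigr => i _; rewrite rmorphB rmorph_nat cfunE [in RHS]mul2n.
  by rewrite -card_fixpoints // -chiE // cfunE natE.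
have val0 m g : g \in W n -> (fixed_pairs g < m)%N ->
    zirr_val (\prod_(i < m) (x - (2 * i)%:R)) g = 0.
  move=> Wg lt; rewrite valE // (bigD1 (Ordinal lt)) //= subrr mul0r //.
exists x.
  apply: val_inj; apply/cfun_inP => g Wg; rewrite [LHS]val0 ?cfunE //.
  by rewrite ltnS fixed_pairs_leq.
set P := \prod_(i < n) _.
have P1 : zirr_val P 1%g = (2 ^ n * n`!)%:R.
  rewrite valE //; have /eqP -> : fixed_pairs 1 == n by rewrite fixed_pairs_max.
  rewrite fact_prod big_add1 /= -[X in (X ^ _)%N]/(2%N).
  transitivity (\prod_(i < n) (2 * (n - i))%:R : algC).
    by apply: eq_bigr => i _; rewrite mulnBr natrB // leq_pmul2l // ltnW.
  rewrite -natr_prod; congr _%:R; rewrite big_split prod_nat_const card_ord /=.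
  congr (_ * _)%N; rewrite big_mkord (reindex_inj rev_ord_inj) /=.
  by apply: eq_bigr => i _; rewrite subKn.
have dotE : '[zirr_val P, 1] = (2 ^ n * n`!)%:R / #|W n|%:R.
  rewrite cfdotE mulrC (bigD1 1%g) // P1 cfun1E group1 rmorph1 mulr1.
  rewrite big1 => [|g /andP[Wg n1g]]; first by rewrite /= addr0.
  rewrite val0 ?mul0r //.
  by rewrite ltn_neqAle fixed_pairs_leq fixed_pairs_max // n1g.
have : '[zirr_val P, 1] \in Num.int.
  by rewrite Cint_cfdot_vchar ?cfun1_vchar //; apply: (valP P).
move=> Zdot; have nzW : (0 : algC) < #|W n|%:R by rewrite ltr0n cardG_gt0.
have le1 : '[zirr_val P, 1] <= 1.
  by rewrite dotE ler_pdivrMr // mul1r ler_nat card_W_geq.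
have gt0 : 0 < '[zirr_val P, 1].
  by rewrite dotE divr_gt0 // ltr0n muln_gt0 expn_gt0 fact_gt0.
case/intrP: Zdot => z zE; move: le1 gt0.
rewrite zE -[1]/(1%:~R) ler_int ltr0z => le1 gt0.
by congr _%:~R; apply/eqP; rewrite eq_le le1 -gtz0_ge1 gt0.
Qed.

End NilpotentElement.

(** * The Loewy length *)

Section LoewyLength.
Import classical_sets.
Local Open Scope group_scope.
Local Open Scope ring_scope.
Variables (K : fieldType) (n : nat).
Local Notation A := (KIrr K (W n)).

Lemma Jacobson_radical0 : Jacobson_radical (0 : A).
Proof. by apply: (@nilpotent_Jacobson_radical A 0 1); rewrite expr1. Qed.

(** f is the product F q of the first q factors X - 2i, where q = p, or q = 1
    if p = 2. The factors repeat with period q, so the powers of f are the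
    products F (s q). *)
Lemma Jacobson_radical_nilpotent_power p : p \in [pchar K] ->
  exists2 f : A, Jacobson_radical f &
    f ^+ (if p == 2%N then n else n %/ p)%N != 0.
Proof.
move=> pK; have p_pr : prime p by case/andP: pK.
have [x prod0 prod1] := vanishing_product_char n.
pose X : A := KIrr_of_ZIrr K x; pose F m := \prod_(i < m) (X - (2 * i)%:R).
have FE m : F m = KIrr_of_ZIrr K (\prod_(i < m) (x - (2 * i)%:R)).
  rewrite rmorph_prod; apply: eq_bigr => i _.
  by rewrite rmorphB rmorph_nat.
have Fn : F n != 0.
  apply/eqP => /rowP/(_ 0)/eqP; rewrite FE /KIrr_of_ZIrr KIrr_of_vchar_coord irr0.
  by rewrite prod1 floor1 mxE oner_eq0.
have FD m l : F (m + l)%N = F m * \prod_(i < l) (X - (2 * (m + i))%:R).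
  by rewrite /F big_split_ord.
have pA : p%:R = 0 :> A.
  by rewrite -[p%:R]scaler_nat (pcharf0 pK) scale0r.
pose q := if p == 2%N then 1%N else p.
have q2 : (2 * q)%:R = 0 :> A.
  rewrite /q; case: eqP pA => [->|_] pA; first by rewrite muln1.
  by rewrite natrM pA mulr0.
have q_gt0 : (0 < q)%N by rewrite /q; case: eqP => // _; apply: prime_gt0.
have nq : (if p == 2%N then n else n %/ p)%N = (n %/ q)%N.
  by rewrite /q; case: eqP => // _; rewrite divn1.
have FqD m : F (q + m)%N = F q * F m.
  rewrite FD; congr (_ * _); apply: eq_bigr => i _.
  by rewrite mulnDr natrD q2 add0r.
have FX s m : F (s * q + m)%N = F q ^+ s * F m.
  elim: s => [|s IHs]; first by rewrite mul1r.
  by rewrite mulSn -addnA FqD IHs exprS mulrA.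
exists (F q); last first.
  rewrite nq; apply: contraNneq Fn => fq0.
  have -> : F n = F (n %/ q * q + n %% q)%N by rewrite -divn_eq.
  by rewrite FX fq0 mul0r.
apply: (@nilpotent_Jacobson_radical A _ (n %/ q).+1).
have -> : F q ^+ (n %/ q).+1 = F ((n %/ q).+1 * q)%N.
  by rewrite -[(_ * q)%N]addn0 FX [F 0]big_ord0 mulr1.
have lt_n : (n < (n %/ q).+1 * q)%N by rewrite ltn_ceil.
by rewrite -(subnKC lt_n) FD FE prod0 rmorph0 mul0r.
Qed.

Lemma Loewy_length_char0 : [pchar K] =i pred0 -> is_Loewy_length A 1.
Proof.
move=> char0; split=> //; apply/seteqP; split=> u /=; last first.
  by move=> ->; apply: (ideal_exp0 1 Jacobson_radical0).
case=> s sP ->; rewrite big_seq big1 // => v /sP[/= J1 _].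
by rewrite (Jacobson_radical_char0 char0 J1) mul0r.
Qed.

Lemma Loewy_length_charp p : p \in [pchar K] ->
  is_Loewy_length A (if p == 2%N then n else n %/ p)%N.+1.
Proof.
move=> pK; split=> //.
  apply/seteqP; split=> u => [|->]; last exact: ideal_exp0 _ Jacobson_radical0.
  by move=> Iu; rewrite [u](Jacobson_radical_exp0 pK (ltnSn _) Iu).
move=> s s_gt0 Is0; have [f Jf] := Jacobson_radical_nilpotent_power pK.
rewrite ltnNge; apply: contra => le_s.
have : ideal_exp (Jacobson_radical (A := A)) s (f ^+ s) by apply: ideal_exp_mem.
by rewrite Is0 -(subnK le_s) exprD => ->; rewrite mulr0.
Qed.

End LoewyLength.

Theorem proposition7p1 (K : fieldType) (p n : nat)
    (hp : has_characteristic K p) (hn : 0 < n) :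
  is_Loewy_length (KIrr K (W n))
    (if p == 0 then 1 else if p == 2 then n.+1 else (n %/ p).+1).
Proof.
move: hp; rewrite /has_characteristic; case: eqP => [_ char0|_ pK].
  exact: Loewy_length_char0.
by have := Loewy_length_charp n pK; case: eqP.
Qed.
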